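(* Fix $2<\beta<3$. Let $G$ be a graph on $n$ vertices generated by the Chung-Lu process with power-law parameter $\beta$ and average expected degree $d$ (possibly depending on $n$, but with $d=n^{o(1)}$). Let $u\neq v$ be a uniformly random pair of vertices of $G$. Then any algorithm that has node query access to $G$ starting at $u$ and $v$ must, with high probability, make $n^{\Omega(1)}$ queries to $G$ in order to find a path between $u$ and $v$.
   Context: Chung-Lu model: given expected degrees $w_1\ge\dots\ge w_n$ following a power-law distribution with exponent $\beta$ (fraction of vertices with expected degree $k$ proportional to $k^{-\beta}$ for large $k$), $W=\sum_i w_i$ with $w_iw_j\le W$, each pair $\{i,j\}$ is independently an edge with probability $w_iw_j/W$. Node query model: the algorithm initially knows only $u$ and $v$; querying a vertex it has discovered reveals that vertex's full neighbor list. *)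

(* Defs.v *)
From HB Require Import structures.
From mathcomp Require Import all_boot all_order all_algebra all_fingroup.
From mathcomp Require Import all_classical all_reals all_analysis.

Set Implicit Arguments.
Unset Strict Implicit.
Unset Printing Implicit Defensive.

Import Order.TTheory GRing.Theory Num.Theory.
Import numFieldNormedType.Exports.
Local Open Scope ring_scope.

(* f(n) = n^{o(1)}; this bounds f from above and from below. *)
Definition subpolynomial (R : realType) (f : nat -> R) : Prop :=
  exists2 e : nat -> R, (e @ \oo --> (0 : R))%classic &
    \forall n \near \oo%classic, f n = n%:R `^ e n.

Definition total_weight (R : realType) (n : nat) (w : 'I_n -> R) : R :=
  \sum_(i < n) w i.

Definition avg_weight (R : realType) (n : nat) (w : 'I_n -> R) : R :=
  total_weight w / n%:R.

(* Expected degrees, listed in nonincreasing order, for which all the numbers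
   w_i w_j / W are probabilities. *)
Definition expected_degrees (R : realType) (n : nat) (w : 'I_n -> R) : Prop :=
  [/\ forall i, 0 <= w i,
      forall i j : 'I_n, (i <= j)%N -> w j <= w i
    & forall i j, w i * w j <= total_weight w].

Definition window_fraction (R : realType) (n : nat) (w : 'I_n -> R)
    (s t : nat) : R :=
  #|[set i | s%:R <= w i < t%:R]|%:R / n%:R.

(* The fraction of vertices of expected degree k is proportional to k^-beta
   for large k.  For k beyond n^(1/beta) this predicts less than one vertex, so
   it cannot hold literally value by value; it is required of the windows [s, t)
   of expected degrees, up to a constant factor C and r vertices of rounding,
   both independent of n.  The normalization a n may depend on n (as it must
   when the average degree does).  "Large k" means k >= K n with
   K n = n^{o(1)}, which allows a constant threshold as well as one of the
   order of the average degree.  The lower bound is only required up to the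
   largest expected degree, which is at most the square root of W; the upper
   bound is required everywhere. *)
Definition power_law (R : realType) (beta : R) (w : forall n, 'I_n -> R) :
    Prop :=
  exists (C r : R) (a : nat -> R) (K : nat -> nat),
  [/\ 0 < C, 0 <= r, forall n, 0 < a n,
      subpolynomial (fun n => (K n)%:R : R)
    & \forall n \near \oo%classic, forall s t : nat, (K n <= s < t)%N ->
      let mass := a n * \sum_(s <= k < t) k%:R `^ (- beta) in
      window_fraction (w n) s t <= C * mass + r / n%:R /\
      ((exists i, t%:R <= w n i) ->
        C^-1 * mass - r / n%:R <= window_fraction (w n) s t)].

(* A graph on 'I_n is given by its edge set, a subset of [vpairs n]. *)
Definition vpairs (n : nat) : {set {set 'I_n}} :=
  [set e : {set 'I_n} | #|e| == 2%N].

(* For e = {i, j} this is w_i w_j / W. *)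
Definition edge_prob (R : realType) (n : nat) (w : 'I_n -> R)
    (e : {set 'I_n}) : R :=
  (\prod_(i in e) w i) / total_weight w.

Definition chung_lu (R : realType) (n : nat) (w : 'I_n -> R)
    (E : {set {set 'I_n}}) : R :=
  \prod_(e in vpairs n) (if e \in E then edge_prob w e else 1 - edge_prob w e).

Definition neighbors (n : nat) (E : {set {set 'I_n}}) (x : 'I_n) :
    {set 'I_n} :=
  [set y | [set x; y] \in E].

(* What has been seen so far: the queried vertices, in order, each with the
   answer received. *)
Definition history (n : nat) := seq ('I_n * {set 'I_n}).

Definition discovered (n : nat) (u v : 'I_n) (h : history n) : {set 'I_n} :=
  [set u; v] :|: \bigcup_(p <- h) p.2.

(* A randomized, adaptive node-query algorithm.  For a given n there are
   finitely many behaviours, so a finite seed is no restriction.  Stopping is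
   the same as querying an already queried vertex forever. *)
Record algorithm (R : realType) (n : nat) := Algorithm {
  seed : finType;
  seed_law : seed -> R;
  seed_law_ge0 : forall c, 0 <= seed_law c;
  seed_law_sum1 : \sum_c seed_law c = 1;
  next_query : seed -> 'I_n -> 'I_n -> history n -> 'I_n;
  next_query_discovered : forall c u v h,
    next_query c u v h \in discovered u v h
}.

Fixpoint transcript (R : realType) (n : nat) (A : algorithm R n)
    (E : {set {set 'I_n}}) (u v : 'I_n) (c : seed A) (q : nat) : history n :=
  if q is q'.+1 then
    let h := transcript E u v c q' in
    let x := next_query c u v h in
    rcons h (x, neighbors E x)
  else [::].

Definition revealed_edge (n : nat) (h : history n) : rel 'I_n :=
  fun x y => has (fun p : 'I_n * {set 'I_n} =>
    (p.1 == x) && (y \in p.2) || (p.1 == y) && (x \in p.2)) h.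

Definition path_found (R : realType) (n : nat) (A : algorithm R n)
    (E : {set {set 'I_n}}) (u v : 'I_n) (c : seed A) (q : nat) : bool :=
  connect (revealed_edge (transcript E u v c q)) u v.

(* The probability of [event E u v c] when E is a Chung-Lu graph, (u, v) a
   uniform pair of distinct vertices and c the seed of A, all independent.  As
   w is sorted, the position of a vertex in w would disclose its expected
   degree, while an algorithm only knows the vertices it has been shown; so
   vertices are named by a uniformly random permutation, the one named x
   having expected degree w (sigma x). *)
Definition query_prob (R : realType) (n : nat) (w : 'I_n -> R)
    (A : algorithm R n)
    (event : {set {set 'I_n}} -> 'I_n -> 'I_n -> seed A -> Prop) : R :=
  \sum_(sigma : 'S_n) \sum_(E : {set {set 'I_n}} | E \subset vpairs n)
  \sum_(u < n) \sum_(v < n | u != v) \sum_(c : seed A | `[< event E u v c >])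
    (n`!%:R)^-1 * chung_lu (w \o sigma) E * (n * n.-1)%:R^-1 * seed_law c.

(* Main.v *)
Require Import Defs.
From mathcomp Require Import all_boot all_order all_algebra all_fingroup.
From mathcomp Require Import all_classical all_reals all_analysis.
From mathcomp Require Import ring lra.
Import Order.TTheory GRing.Theory Num.Theory.
Import numFieldNormedType.Exports.
Local Open Scope ring_scope.

(* A vertex reached by following an edge is size-biased, so it has weight at
   least n^g with probability about n^(-g(beta-2)); an algorithm making few
   queries therefore only ever queries light vertices. A light vertex has
   few neighbours, and since every weight is at most sqrt W, it is adjacent
   to a vertex already seen (but not queried) with probability about
   n^(g-1/2) per such vertex. Hence the explored graph stays a forest in
   which u and v lie in different components. The size bias is obtained
   without computing conditional laws: exchanging the names of the next
   queried vertex and of an unseen vertex changes the probability of the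
   history by a controlled factor. *)

(** The law of the weights given the history is intractable, since an adaptive algorithm picks its
    next vertex from everything seen. The exchange bypasses it because names are themselves random:
    composing the naming with the transposition of y and z, and exchanging all their edges except
    the two pairs with the parent of y, is a bijection on the pairs (naming, graph). It fixes the
    history provided that y has a single queried neighbour and z has none, which is why the forest
    shape is part of the event being bounded. Summing over the undiscovered z turns the factors w_y
    / w_z into heavy weight over total weight, as long as the discovered vertices hold at most half
    of W. Lightness of the queried vertices serves three times: it bounds the number of neighbours,
    the chance of a collision, and the probability of the edge to the parent, which must be at most
    1/2 for the exchange. *)

Section RandomSubset.
Set Implicit Arguments.
Unset Strict Implicit.
Variables (R : realType) (T : finType) (V : {set T}).
Implicit Types (p : T -> R) (E : {set T}).

(** [chung_lu w] is by conversion the case [V := vpairs n], [p := edge_prob w]. *)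
Definition subset_prob p E : R :=
  \prod_(e in V) (if e \in E then p e else 1 - p e).

Lemma subset_prob_ge0 p E : (forall e, e \in V -> 0 <= p e <= 1) ->
  0 <= subset_prob p E.
Proof.
move=> p01; apply: prodr_ge0 => e /p01/andP[p0 p1].
by case: ifP => _ //; rewrite subr_ge0.
Qed.

Lemma sum_subset_prob p : \sum_(E : {set T} | E \subset V) subset_prob p E = 1.
Proof.
(* Outside [V] the weights 0 and 1 force exclusion, so that a product over all of [T] expands into
   the sum over the subsets of [V]. *)
pose F i := if i \in V then p i else 0.
pose G i := if i \in V then 1 - p i else 1.
transitivity (\prod_i (F i + G i)); last first.
  by apply: big1 => i _; rewrite /F /G; case: ifP => _; rewrite ?add0r // addrC subrK.
rewrite bigA_distr big_mkcond /=; apply: eq_bigr => E _.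
case: ifP => [sEV|/negbT/fintype.subsetPn[i iE iV]]; last first.
  by rewrite (bigD1 i) //= iE /F (negbTE iV) mul0r.
rewrite /subset_prob big_mkcond /=; apply: eq_bigr => i _; rewrite /F /G.
by case: ifP => // iV; case: ifP => // /(fintype.subsetP sEV); rewrite iV.
Qed.

(** Independence of [e \in E] from any quantity that ignores [e]: pairing each [E] without [e] with
    [e |: E] isolates the factor of [e]. *)
Lemma sum_subset_prob_mem p e (f : {set T} -> R) : e \in V ->
    (forall E, f (e |: E) = f E) ->
  \sum_(E : {set T} | E \subset V) subset_prob p E * ((e \in E)%:R * f E) =
  p e * \sum_(E : {set T} | E \subset V) subset_prob p E * f E.
Proof.
move=> eV fe.
pose K E := \prod_(i in V | i != e) (if i \in E then p i else 1 - p i).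
have muE E : subset_prob p E = (if e \in E then p e else 1 - p e) * K E.
  by rewrite /subset_prob (bigD1 e).
have KU E : K (e |: E) = K E.
  by apply: eq_bigr => i /andP[_ ie]; rewrite !inE (negbTE ie).
pose S0 := \sum_(E : {set T} | (E \subset V) && (e \notin E)) K E * f E.
have S1E : \sum_(E : {set T} | (E \subset V) && (e \in E)) K E * f E = S0.
  rewrite (reindex_onto (fun E => e |: E) (fun E => E :\ e)); last first.
    by move=> E /andP[_ eE]; exact: finset.setD1K.
  apply: eq_big => [E|E _]; last by rewrite KU fe.
  rewrite finset.subUset finset.sub1set eV finset.setU11 /= andbT; congr (_ && _).
  by apply/eqP/idP => [<-|/finset.setU1K //]; rewrite !inE eqxx.
have -> : \sum_(E : {set T} | E \subset V) subset_prob p E * ((e \in E)%:R * f E)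
    = p e * S0.
  rewrite -S1E mulr_sumr big_mkcondr /=; apply: eq_bigr => E _.
  by rewrite muE; case: ifP; rewrite ?mul0r ?mulr0 // mul1r mulrA.
congr (_ * _); rewrite (bigID (fun E => e \in E)) /=.
rewrite (eq_bigr (fun E => p e * (K E * f E))); last first.
  by move=> E /andP[_ eE]; rewrite muE eE mulrA.
rewrite -mulr_sumr S1E.
rewrite (eq_bigr (fun E => (1 - p e) * (K E * f E))); last first.
  by move=> E /andP[_ /negbTE eE]; rewrite muE eE mulrA.
by rewrite -mulr_sumr -/S0 -mulrDl addrC subrK mul1r.
Qed.

End RandomSubset.

(** * Deterministic part: exploration of a fixed graph *)

Section Exploration.
Set Implicit Arguments.
Unset Strict Implicit.
Variables (R : realType) (n : nat) (A : algorithm R n) (u v : 'I_n) (c : seed A).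
Implicit Types (E : {set {set 'I_n}}) (h : history n) (t M : nat) (x y : 'I_n).
Implicit Types LS : {set 'I_n}.

Local Notation tr E t := (transcript E u v c t).
Local Notation next h := (next_query c u v h).
Local Notation disc h := (discovered u v h).

Definition queried h : {set 'I_n} := [set x in [seq p.1 | p <- h]].

Lemma queried_rcons h p : queried (rcons h p) = p.1 |: queried h.
Proof. by apply/setP => x; rewrite !inE map_rcons mem_rcons inE. Qed.

Lemma discovered_rcons h p : disc (rcons h p) = disc h :|: p.2.
Proof. by rewrite /discovered big_rcons /= finset.setUA. Qed.

Lemma mem_neighbors E x y : (y \in neighbors E x) = ([set x; y] \in E).
Proof. by rewrite inE. Qed.

Lemma neighbors_sym E x y : (y \in neighbors E x) = (x \in neighbors E y).
Proof. by rewrite !mem_neighbors finset.setUC. Qed.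

Lemma transcript_answer E t p : p \in tr E t -> p.2 = neighbors E p.1.
Proof.
elim: t => [|t IH] //=; rewrite mem_rcons inE => /orP[/eqP-> //|]; exact: IH.
Qed.

Lemma mem_transcript E t x :
  x \in queried (tr E t) -> (x, neighbors E x) \in tr E t.
Proof.
rewrite inE => /mapP[p ph ->].
by rewrite -(transcript_answer ph); case: p ph.
Qed.

Lemma transcript_queried E t p : p \in tr E t -> p.1 \in queried (tr E t).
Proof. by move=> ph; rewrite inE; apply/mapP; exists p. Qed.

Lemma queriedS E t x :
  x \in queried (tr E t) -> x \in queried (tr E t.+1).
Proof. by rewrite /= queried_rcons !inE => ->; rewrite orbT. Qed.

Lemma next_queriedS E t : next (tr E t) \in queried (tr E t.+1).
Proof. by rewrite /= queried_rcons !inE eqxx. Qed.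

(** Two graphs giving the same answers along one run produce the same run; this is what lets events
    on histories be transported between graphs. *)
Lemma eq_transcript E E' t :
    (forall x, x \in queried (tr E t) -> neighbors E' x = neighbors E x) ->
  tr E' t = tr E t.
Proof.
elim: t => [|t IH] //= EE'.
have trE : tr E' t = tr E t by apply: IH => x xq; apply: EE'; exact: queriedS.
by rewrite trE EE' //; exact: next_queriedS.
Qed.

Lemma queried_sub_discovered E t : queried (tr E t) \subset disc (tr E t).
Proof.
elim: t => [|t IH] /=.
  by apply/fintype.subsetP => x; rewrite inE.
rewrite queried_rcons discovered_rcons finset.subUset finset.sub1set /= inE.
by rewrite next_query_discovered /= (fintype.subset_trans IH) // finset.subsetUl.
Qed.

Lemma discoveredP E t y :
  reflect [\/ y = u, y = v | exists2 x, x \in queried (tr E t) & y \in neighbors E x]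
          (y \in disc (tr E t)).
Proof.
elim: t => [|t IH] /=.
  rewrite /discovered big_nil finset.setU0 !inE.
  apply: (iffP orP) => [[/eqP->|/eqP->]|[->|->|[x]]]; rewrite ?eqxx;
    [exact: Or31|exact: Or32|by left|by right|by rewrite inE].
rewrite discovered_rcons inE; apply: (iffP orP) => /= [[/IH[]|yx]|[yE|yE|[x]]].
- exact: Or31.
- exact: Or32.
- by case=> x xq yx; apply: Or33; exists x => //; rewrite queried_rcons inE xq orbT.
- by apply: Or33; exists (next (tr E t)) => //; rewrite queried_rcons !inE eqxx.
- by left; apply/IH; exact: Or31.
- by left; apply/IH; exact: Or32.
rewrite queried_rcons 2!inE => /orP[/eqP-> yx|xq yx]; first by right.
by left; apply/IH/Or33; exists x.
Qed.

Lemma neighbor_discovered E t x y :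
  x \in queried (tr E t) -> y \in neighbors E x -> y \in disc (tr E t).
Proof. by move=> xq yx; apply/discoveredP/Or33; exists x. Qed.

(** Repeating a query reveals nothing, so it is always good. Neighbours already queried are exempt
    from both conditions, since the parent of [x] is one of them. *)
Definition step_ok LS M E h : bool :=
  let x := next h in
  (x \in queried h) ||
  [&& x \in LS, (#|neighbors E x :\: queried h| <= M)%N
    & [disjoint neighbors E x & disc h :\: queried h]].

(* The exploration stays good as long as only vertices of the set LS (the
   light ones) get queried and every query attaches a small tree of new
   vertices to the explored forest. *)
Fixpoint explore_ok LS M E t : bool :=
  if t is t'.+1 then explore_ok LS M E t' && step_ok LS M E (tr E t')
  else (u \in LS) && (v \in LS).

(** The light set may change too, because exchanging the weights of two unqueried vertices can alter
    their lightness. *)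
Lemma eq_explore_ok LS LS' M E E' t :
    (forall x, x \in queried (tr E t) -> neighbors E' x = neighbors E x) ->
    (u \in LS') = (u \in LS) -> (v \in LS') = (v \in LS) ->
    (forall x, x \in queried (tr E t) -> (x \in LS') = (x \in LS)) ->
  explore_ok LS' M E' t = explore_ok LS M E t.
Proof.
move=> EE' uL vL; elim: t EE' => [|t IH] EE' L; first by rewrite /= uL vL.
have EE't x : x \in queried (tr E t) -> neighbors E' x = neighbors E x.
  by move=> xq; apply: EE'; exact: queriedS.
rewrite [LHS]/= [RHS]/= IH //; last by move=> x xq; apply: L; exact: queriedS.
congr (_ && _); rewrite (eq_transcript EE't) /step_ok.
by rewrite EE' ?L //; exact: next_queriedS.
Qed.

Lemma explore_ok_light LS M E t :
  explore_ok LS M E t -> queried (tr E t) \subset LS.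
Proof.
elim: t => [|t IH] /=; first by move=> _; apply/fintype.subsetP => x; rewrite inE.
case/andP=> /IH sL /orP[xq|/and3P[xL _ _]];
  rewrite queried_rcons finset.subUset finset.sub1set sL andbT //=.
exact: (fintype.subsetP sL).
Qed.

Lemma explore_ok_ends LS M E t :
  explore_ok LS M E t -> (u \in LS) && (v \in LS).
Proof. by elim: t => [|t IH] //= /andP[/IH]. Qed.

Lemma explore_ok_le LS M E s t :
  (s <= t)%N -> explore_ok LS M E t -> explore_ok LS M E s.
Proof.
elim: t => [|t IH]; first by rewrite leqn0 => /eqP->.
by rewrite leq_eqVlt => /orP[/eqP-> //|/IH{}IH] /= /andP[/IH].
Qed.

(** Parents are unique: a second parent would, when queried, be adjacent to an already discovered,
    unqueried vertex. The exchange argument relies on this both to preserve the answers and to have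
    only one term per history. *)
Lemma explore_ok_forest LS M E t x x' y : explore_ok LS M E t ->
    y \notin queried (tr E t) ->
    x \in queried (tr E t) -> x' \in queried (tr E t) ->
    y \in neighbors E x -> y \in neighbors E x' ->
  x = x'.
Proof.
elim: t x x' => [|t IH] x x' /=; first by rewrite !inE.
case/andP=> ok step; rewrite !queried_rcons !finset.in_setU1 negb_or /= => /andP[_ yq].
have new z : z \in queried (tr E t) -> y \in neighbors E z ->
    y \in neighbors E (next (tr E t)) -> next (tr E t) \in queried (tr E t).
  move=> zq yz yx; case/orP: step => // /and3P[_ _ /disjoint_setI0/setP/(_ y)].
  by rewrite finset.in_setI yx finset.in_setD yq (neighbor_discovered zq yz) inE.
case/orP=> [/eqP->|xq]; case/orP=> [/eqP->|x'q] // yx yx'; apply: IH => //.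
- exact: (new x').
- exact: (new x).
Qed.

Lemma card_discovered LS M E t :
  explore_ok LS M E t -> (#|disc (tr E t)| <= 2 + t * M)%N.
Proof.
elim: t => [|t IH] /=.
  by rewrite /discovered big_nil finset.setU0 cards2; case: eqP.
case/andP=> /IH{}IH /orP[xq|/and3P[_ dM _]]; rewrite discovered_rcons /=.
  rewrite (finset.setUidPl _) ?(leq_trans IH) ?leq_add2l ?leq_mul //.
  by apply/fintype.subsetP => y; exact: neighbor_discovered.
set x := next _; set h := transcript _ _ _ _ _.
have -> : disc h :|: neighbors E x = disc h :|: (neighbors E x :\: queried h).
  have := queried_sub_discovered E t; rewrite -/h.
  move: (disc h) => D /fintype.subsetP qD.
  apply/setP => y; rewrite !finset.in_setU finset.in_setD.
  case: (boolP (y \in queried h)) => //= yq.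
  by rewrite qD.
rewrite (leq_trans (leq_card_setU _ _)) //= mulSn addnCA addnC leq_add //.
Qed.

Lemma explore_ok_separated LS M E t : u != v ->
  explore_ok LS M E t -> ~~ connect (revealed_edge (tr E t)) u v.
Proof.
move=> uv ok.
(* [S] plays the role of the component of [u]. Keeping it inside the discovered set ensures that a
   fresh vertex lies outside [S] until it is attached. *)
suff [S [uS vS _ clS]] : exists S : {set 'I_n}, [/\ u \in S, v \notin S,
    S \subset disc (tr E t) & fingraph.closed (revealed_edge (tr E t)) S].
  by apply/negP => /(closed_connect clS); rewrite uS (negbTE vS).
elim: t ok => [|t IH] /=.
  move=> _; exists [set u]; split; rewrite ?inE ?eqxx 1?eq_sym //.
  by rewrite finset.sub1set !inE eqxx.
case/andP=> /IH[S [uS vS sS clS]]; set x := next _; set h := transcript _ _ _ _ _.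
have rE a b : revealed_edge (rcons h (x, neighbors E x)) a b ->
    [\/ revealed_edge h a b, a = x /\ b \in neighbors E x
      | b = x /\ a \in neighbors E x].
  rewrite /revealed_edge has_rcons => /orP[/orP[]/andP[/eqP/= <-]|] ?;
    [exact: Or32|exact: Or33|exact: Or31].
have qE a b : a \in queried h -> b \in neighbors E a -> revealed_edge h a b.
  move=> aq ba; apply/hasP; exists (a, neighbors E a); first exact: mem_transcript.
  by rewrite /= eqxx ba.
have symE a b : revealed_edge h a b = revealed_edge h b a.
  by apply: eq_has => p; rewrite orbC.
case/orP=> [xq|/and3P[_ _ dN]].
  exists S; split=> //; first by rewrite discovered_rcons finset.subsetU ?sS.
  move=> a b /rE[/clS //|[-> bx]|[-> ax]]; first exact/clS/qE.
  by apply/esym/clS/qE.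
(* Fresh neighbours go to the side of [x]; [v] is discovered from the start, hence never fresh. *)
exists (if x \in S then S :|: (neighbors E x :\: disc h) else S); split.
- by case: ifP; rewrite // inE uS.
- case: ifP => // _; rewrite inE (negbTE vS) !inE negb_and negbK.
  by rewrite eqxx orbT.
- rewrite discovered_rcons; case: ifP => _; last by rewrite finset.subsetU ?sS.
  by rewrite finset.setUSS // finset.subsetDl.
have inS a : a \in disc h ->
    (a \in if x \in S then S :|: (neighbors E x :\: disc h) else S) = (a \in S).
  by move=> ad; case: ifP => // _; rewrite inE [in X in _ || X]inE ad orbF.
have revd a b : revealed_edge h a b -> a \in disc h.
  case/hasP=> p ph /orP[/andP[/eqP<- _]|/andP[_ ap]].
    exact/(fintype.subsetP (queried_sub_discovered E t))/transcript_queried.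
  apply: (neighbor_discovered (transcript_queried ph)).
  by rewrite -(transcript_answer ph).
have old a b : revealed_edge h a b -> (a \in S) = (b \in S) by exact: clS.
(* A neighbour of [x] discovered earlier must already be queried, by disjointness, so its edge to
   [x] was revealed before and [S] respects it. *)
have star b : b \in neighbors E x ->
    (x \in if x \in S then S :|: (neighbors E x :\: disc h) else S) =
    (b \in if x \in S then S :|: (neighbors E x :\: disc h) else S).
  move=> bx; have xd : x \in disc h by exact: next_query_discovered.
  rewrite (inS x) //; case: (boolP (b \in disc h)) => bd.
    rewrite (inS b) //; apply: clS; rewrite symE; apply: qE; last first.
      by rewrite neighbors_sym.
    move/disjoint_setI0/setP/(_ b): dN.
    by rewrite finset.in_setI bx finset.in_setD bd andbT finset.in_set0 => /negbFE.
  case: ifP => xS; first by rewrite inE [in X in _ || X]inE bd bx orbT.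
  by apply/esym/negP => /(fintype.subsetP sS); rewrite (negbTE bd).
move=> a b /rE[ab|[-> bx]|[-> ax]]; [|exact: star|exact/esym/star].
by rewrite (inS a) ?(inS b) ?(revd a b) ?(revd b a) ?(old a b) // symE.
Qed.

End Exploration.

(** * The Chung-Lu law and the exchange of two vertices *)

Section ChungLu.
Set Implicit Arguments.
Unset Strict Implicit.
Variables (R : realType) (n : nat).
Implicit Types (w : 'I_n -> R) (E : {set {set 'I_n}}) (x y z : 'I_n).

Lemma pair_in_vpairs x y : ([set x; y] \in vpairs n) = (x != y).
Proof. by rewrite inE cards2; case: (x == y). Qed.

Lemma edge_prob_pair w x y : x != y ->
  edge_prob w [set x; y] = w x * w y / total_weight w.
Proof. by move=> xy; rewrite /edge_prob big_setU1 ?inE //= big_set1. Qed.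

Lemma edge_prob01 w e : (forall i, 0 <= w i) ->
    (forall i j, w i * w j <= total_weight w) ->
  e \in vpairs n -> 0 <= edge_prob w e <= 1.
Proof.
move=> w0 wM; rewrite inE => /cards2P[x [y [xy ->]]].
have W0 : 0 <= total_weight w by exact: sumr_ge0.
rewrite edge_prob_pair // divr_ge0 ?mulr_ge0 //=.
move: W0; rewrite le_eqVlt => /orP[/eqP<-|W0]; first by rewrite invr0 mulr0.
by rewrite ler_pdivrMr // mul1r.
Qed.

Lemma total_weight_perm w (s : 'S_n) : total_weight (w \o s) = total_weight w.
Proof. by rewrite /total_weight [RHS](reindex_inj (@perm_inj _ s)). Qed.

Lemma chung_lu_ge0 w E : (forall i, 0 <= w i) ->
  (forall i j, w i * w j <= total_weight w) -> 0 <= chung_lu w E.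
Proof. by move=> w0 wM; apply: subset_prob_ge0 => e; exact: edge_prob01. Qed.

Lemma sum_chung_lu w :
  \sum_(E : {set {set 'I_n}} | E \subset vpairs n) chung_lu w E = 1.
Proof. exact: sum_subset_prob. Qed.

(** The pairs joining [x] to [y] and [z] stay put so that the answer of [x], which contains [y] but
    not [z], is unchanged. *)
Definition swap_pairs x y z (e : {set 'I_n}) : {set 'I_n} :=
  if (e == [set x; y]) || (e == [set x; z]) then e else tperm y z @: e.

Lemma imset_pair (f : 'I_n -> 'I_n) x y : f @: [set x; y] = [set f x; f y].
Proof. by rewrite imsetU !imset_set1. Qed.

Lemma imset_tpermK y z : involutive (fun e : {set 'I_n} => tperm y z @: e).
Proof.
move=> e; rewrite -imset_comp -[RHS]imset_id; apply: eq_imset => i /=.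
exact: tpermK.
Qed.

Lemma swap_pairsK x y z : x != y -> x != z -> involutive (swap_pairs x y z).
Proof.
move=> xy xz e; rewrite {2}/swap_pairs; case: ifPn => [eE|].
  by rewrite /swap_pairs eE.
rewrite negb_or => /andP[exy exz].
have tE a b c : tperm y z @: [set a; b] = c -> (tperm y z @: e == c) = (e == [set a; b]).
  by move=> <-; rewrite (inj_eq (inv_inj (@imset_tpermK y z))).
rewrite /swap_pairs (tE x z) ?(tE x y); last 2 first.
- by rewrite imset_pair tpermL tpermD // eq_sym.
- by rewrite imset_pair tpermR tpermD // eq_sym.
by rewrite (negbTE exy) (negbTE exz) imset_tpermK.
Qed.

Lemma swap_pairs_vpairs x y z e : (swap_pairs x y z e \in vpairs n) = (e \in vpairs n).
Proof.
by rewrite /swap_pairs; case: ifP => // _; rewrite !inE card_imset //; exact: perm_inj.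
Qed.

Definition swap_graph x y z E : {set {set 'I_n}} := swap_pairs x y z @^-1: E.

Lemma mem_swap_graph x y z E e :
  (e \in swap_graph x y z E) = (swap_pairs x y z e \in E).
Proof. by rewrite inE. Qed.

Lemma swap_graphK x y z : x != y -> x != z -> involutive (swap_graph x y z).
Proof. by move=> xy xz E; apply/setP => e; rewrite !mem_swap_graph swap_pairsK. Qed.

Lemma swap_graph_sub x y z E : x != y -> x != z ->
  (swap_graph x y z E \subset vpairs n) = (E \subset vpairs n).
Proof.
move=> xy xz; apply/fintype.subsetP/fintype.subsetP => EV e eE.
  by rewrite -(swap_pairs_vpairs x y z) EV // mem_swap_graph swap_pairsK.
by rewrite -(swap_pairs_vpairs x y z) EV // -mem_swap_graph.
Qed.

Lemma neighbors_swap_graph x y z E q : x != y -> x != z -> q != y -> q != z ->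
    (q != x -> (y \notin neighbors E q) && (z \notin neighbors E q)) ->
  neighbors (swap_graph x y z E) q = neighbors E q.
Proof.
move=> xy xz qy qz qN; apply/setP => i; rewrite !mem_neighbors mem_swap_graph /swap_pairs.
case: ifPn => //; rewrite negb_or => /andP[e1 e2]; rewrite imset_pair.
rewrite (tpermD (z := q)) 1?eq_sym //.
have [qx|/qN/andP[]] := eqVneq q x.
  case: tpermP => // iE; [move: e1|move: e2]; by rewrite qx iE eqxx.
by rewrite !mem_neighbors; case: tpermP => // -> /negbTE-> /negbTE->.
Qed.

(* Exchanging the weights of [y] and [z] keeps the law of the graph, except on
   the two pairs joining [y] and [z] to the parent [x] of [y]. *)
Lemma chung_lu_swap w E x y z : (forall i, 0 <= w i) ->
    (forall i j, w i * w j <= total_weight w) ->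
    x != y -> x != z -> y != z ->
    [set x; y] \in E -> [set x; z] \notin E ->
    2 * (w x * w y) <= total_weight w ->
  w z * chung_lu w E <=
    2 * w y * chung_lu (w \o tperm y z) (swap_graph x y z E).
Proof.
move=> w0 wM xy xz yz xyE xzE small.
set W := total_weight w; set w' := w \o tperm y z.
have W'E : total_weight w' = W by exact: total_weight_perm.
pose F (v : 'I_n -> R) e (b : bool) := if b then edge_prob v e else 1 - edge_prob v e.
pose K := \prod_(e in vpairs n | (e != [set x; y]) && (e != [set x; z]))
  F w e (e \in E).
have pair_neq : [set x; z] != [set x; y].
  apply/eqP => /setP/(_ z); rewrite !inE eqxx orbT.
  by rewrite eq_sym (negbTE xz) eq_sym (negbTE yz).
have two (G : {set 'I_n} -> R) : \prod_(e in vpairs n) G e = G [set x; y] *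
    (G [set x; z] * \prod_(e in vpairs n | (e != [set x; y]) && (e != [set x; z])) G e).
  rewrite (bigD1 [set x; y]) ?pair_in_vpairs //= (bigD1 [set x; z]) /=; last first.
    by rewrite pair_in_vpairs xz.
  by congr (_ * (_ * _)); apply: eq_bigl => e; rewrite andbA.
have K0 : 0 <= K.
  apply: prodr_ge0 => e /andP[eV _]; have /andP[] := edge_prob01 w0 wM eV.
  by rewrite /F; case: ifP; rewrite ?subr_ge0.
have -> : chung_lu w E = w x * w y / W * ((1 - w x * w z / W) * K).
  rewrite /chung_lu two xyE (negbTE xzE) !edge_prob_pair //.
have -> : chung_lu w' (swap_graph x y z E) = w x * w z / W * ((1 - w x * w y / W) * K).
  rewrite /chung_lu (reindex_inj (inv_inj (swap_pairsK xy xz))) /=.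
  rewrite (eq_bigl (mem (vpairs n))); last by move=> e; exact: swap_pairs_vpairs.
  rewrite (eq_bigr (fun e => F w' (swap_pairs x y z e) (e \in E))); last first.
    by move=> e _; rewrite mem_swap_graph swap_pairsK.
  rewrite two xyE (negbTE xzE) /F {1 2}/swap_pairs !eqxx orbT /=.
  rewrite !edge_prob_pair // W'E /w' /= tpermL tpermR tpermD 1?eq_sym //.
  congr (_ * (_ * _)); apply: eq_bigr => e /and3P[_ e1 e2].
  rewrite /swap_pairs (negbTE e1) (negbTE e2) /=.
  suff -> : edge_prob w' (tperm y z @: e) = edge_prob w e by [].
  rewrite /edge_prob W'E big_imset /=; last by move=> ? ? _ _; exact: perm_inj.
  by congr (_ / _); apply: eq_bigr => i _; rewrite /w' /= tpermK.
have W0 : 0 <= W by exact: sumr_ge0.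
have p0 i j : 0 <= w i * w j / W by rewrite divr_ge0 ?mulr_ge0.
(* Origin of the factor 2: with p and q the probabilities of [[set x; y]] and [[set x; z]], the
   exceptional pairs contribute p(1 - q) on one side and q(1 - p) on the other. As w_z p = w_y q, it
   remains to see 1 - q <= 2(1 - p), which follows from p <= 1/2. *)
have xy2 : 2 * (w x * w y / W) <= 1.
  move: W0; rewrite le_eqVlt => /orP[/eqP<-|W0]; first by rewrite invr0 !mulr0.
  by rewrite mulrA ler_pdivrMr // mul1r.
have := p0 x z; set q := w x * w z / W => q0.
have -> : w z * (w x * w y / W * ((1 - q) * K)) = w y * (q * K) * (1 - q).
  by rewrite /q; ring.
have -> : 2 * w y * (q * ((1 - w x * w y / W) * K)) =
   w y * (q * K) * (2 * (1 - w x * w y / W)) by ring.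
apply: ler_wpM2l; first by rewrite mulr_ge0 // mulr_ge0.
by move: q0 xy2; lra.
Qed.

End ChungLu.

(** * Expectation over the naming and the graph *)

Section Expectation.
Set Implicit Arguments.
Unset Strict Implicit.
Variables (R : realType) (n : nat) (w : 'I_n -> R).
Hypothesis w_ge0 : forall i, 0 <= w i.
Hypothesis w_mul_le : forall i j, w i * w j <= total_weight w.
Implicit Types (f g : 'S_n -> {set {set 'I_n}} -> R) (sigma : 'S_n).

Definition expect f : R :=
  \sum_(sigma : 'S_n) \sum_(E : {set {set 'I_n}} | E \subset vpairs n)
    (n`!%:R)^-1 * (chung_lu (w \o sigma) E * f sigma E).

Lemma chung_lu_perm_ge0 sigma (E : {set {set 'I_n}}) : 0 <= chung_lu (w \o sigma) E.
Proof. by apply: chung_lu_ge0 => *; rewrite ?total_weight_perm /=. Qed.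

Lemma le_expect f g :
    (forall sigma (E : {set {set 'I_n}}), E \subset vpairs n -> f sigma E <= g sigma E) ->
  expect f <= expect g.
Proof.
move=> fg; apply: ler_sum => s _; apply: ler_sum => E EV.
by rewrite ler_wpM2l ?invr_ge0 ?ler0n // ler_wpM2l ?chung_lu_perm_ge0 ?fg.
Qed.

Lemma expectD f g : expect (fun s E => f s E + g s E) = expect f + expect g.
Proof.
rewrite /expect -big_split; apply: eq_bigr => s _; rewrite -big_split.
by apply: eq_bigr => E _; rewrite !mulrDr.
Qed.

Lemma expectZ a f : expect (fun s E => a * f s E) = a * expect f.
Proof.
rewrite /expect mulr_sumr; apply: eq_bigr => s _; rewrite mulr_sumr.
by apply: eq_bigr => E _; ring.
Qed.

Lemma expect_sum (I : finType) (F : I -> 'S_n -> {set {set 'I_n}} -> R) :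
  expect (fun s E => \sum_i F i s E) = \sum_i expect (F i).
Proof.
rewrite /expect [RHS]exchange_big; apply: eq_bigr => s _.
rewrite [RHS]exchange_big; apply: eq_bigr => E _.
by rewrite !mulr_sumr.
Qed.

Lemma sum_perm_avg (b : R) : \sum_(s : 'S_n) (n`!%:R)^-1 * b = b.
Proof.
by rewrite sumr_const card_Sn -[LHS]mulr_natr mulrAC mulVf ?mul1r //.
Qed.

Lemma expect_le_fixed f b :
    (forall sigma, \sum_(E : {set {set 'I_n}} | E \subset vpairs n)
       chung_lu (w \o sigma) E * f sigma E <= b) ->
  expect f <= b.
Proof.
move=> fb; apply: (@le_trans _ _ (\sum_(s : 'S_n) (n`!%:R)^-1 * b)).
  apply: ler_sum => s _; rewrite -mulr_sumr ler_wpM2l ?invr_ge0 ?ler0n //.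
by rewrite sum_perm_avg.
Qed.

Lemma expect_cst b : expect (fun _ _ => b) = b.
Proof.
rewrite /expect; under eq_bigr do rewrite -mulr_sumr -mulr_suml sum_chung_lu mul1r.
by rewrite sum_perm_avg.
Qed.

Lemma sum_perm_weight x : n%:R * (\sum_(s : 'S_n) w (s x)) = n`!%:R * total_weight w.
Proof.
have eqx y : \sum_(s : 'S_n) w (s y) = \sum_(s : 'S_n) w (s x).
  rewrite (reindex_inj (@mulgI _ (tperm x y))) /=; apply: eq_bigr => s _.
  by rewrite permM tpermR.
transitivity (\sum_(y < n) \sum_(s : 'S_n) w (s y)).
  by under [RHS]eq_bigr do rewrite eqx; rewrite sumr_const card_ord -[RHS]mulr_natl.
rewrite exchange_big /=.
rewrite (eq_bigr (fun=> total_weight w)); last first.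
  by move=> s _; rewrite -(total_weight_perm w s).
by rewrite sumr_const card_Sn -[LHS]mulr_natl.
Qed.

(** Markov's inequality: under a random naming, a fixed name has mean weight W / n. *)
Lemma expect_heavy_le x (l : R) : 0 < l ->
  expect (fun s _ => ((l <= w (s x))%R)%:R) <= total_weight w / n%:R / l.
Proof.
move=> l0; have n0 : (0 < n)%N by case: n x => [[]|].
have n0' : n%:R != 0 :> R by rewrite pnatr_eq0 -lt0n.
apply: (@le_trans _ _ (expect (fun s _ => l^-1 * w (s x)))).
  apply: le_expect => s E _; case: (leP l (w (s x))) => [lw|_] /=; last by apply: mulr_ge0; rewrite ?invr_ge0 ?(ltW l0).
  by rewrite mulrC ler_pdivlMr // mul1r.
rewrite expectZ mulrC ler_wpM2r ?invr_ge0 ?(ltW l0) //.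
rewrite /expect; under eq_bigr do rewrite -mulr_sumr -mulr_suml sum_chung_lu mul1r.
rewrite -mulr_sumr ler_pdivlMr ?ltr0n // -mulrA [_ * n%:R]mulrC sum_perm_weight.
by rewrite mulrA mulVf ?mul1r // pnatr_eq0 -lt0n fact_gt0.
Qed.

End Expectation.

(** * Edges between unqueried vertices are independent of the history *)

Section Steps.
Set Implicit Arguments.
Unset Strict Implicit.
Variables (R : realType) (n : nat) (A : algorithm R n) (u v : 'I_n) (c : seed A).
Implicit Types (E : {set {set 'I_n}}) (h : history n) (t M : nat) (x y z : 'I_n).

Local Notation tr E t := (transcript E u v c t).
Local Notation next h := (next_query c u v h).
Local Notation disc h := (discovered u v h).

Lemma neighbors_add_pair E x y q : q != x -> q != y ->
  neighbors ([set x; y] |: E) q = neighbors E q.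
Proof.
move=> qx qy; apply/setP => i; rewrite !mem_neighbors finset.in_setU1.
case: eqP => // /setP/(_ q); rewrite !inE eqxx /=.
by rewrite (negbTE qx) (negbTE qy).
Qed.

(** Adding the pair changes only the answers of [x] and [y], so a run that queries neither cannot
    notice it. *)
Lemma transcript_add_pair (B : pred (history n)) t E x y :
    (forall h, B h -> x \notin queried h /\ y \notin queried h) ->
  B (tr ([set x; y] |: E) t) = B (tr E t).
Proof.
move=> BQ; have neq h q : B h -> q \in queried h -> q != x /\ q != y.
  by move=> /BQ[xq yq] qq; split; apply: contraTneq qq => ->.
apply/idP/idP => Bh.
  rewrite (@eq_transcript _ _ A u v c ([set x; y] |: E) E t) // => q /(neq _ _ Bh)[qx qy].
  by rewrite neighbors_add_pair.
rewrite (@eq_transcript _ _ A u v c E ([set x; y] |: E) t) // => q /(neq _ _ Bh)[qx qy].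
by rewrite neighbors_add_pair.
Qed.

Section FixedWeights.
Variable w : 'I_n -> R.
Hypothesis w_ge0 : forall i, 0 <= w i.
Hypothesis w_mul_le : forall i j, w i * w j <= total_weight w.

Lemma sum_unseen_edge (B : pred (history n)) t x y : x != y ->
    (forall h, B h -> x \notin queried h /\ y \notin queried h) ->
  \sum_(E : {set {set 'I_n}} | E \subset vpairs n)
     chung_lu w E * (([set x; y] \in E)%:R * (B (tr E t))%:R) =
  w x * w y / total_weight w *
  \sum_(E : {set {set 'I_n}} | E \subset vpairs n) chung_lu w E * (B (tr E t))%:R.
Proof.
move=> xy BQ; rewrite -edge_prob_pair //.
apply: (@sum_subset_prob_mem _ _ _ _ _ (fun E => (B (tr E t))%:R)).
  by rewrite pair_in_vpairs.
by move=> E; rewrite transcript_add_pair.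
Qed.

(** Once the next vertex [x] and a candidate [y] are fixed, the edge between them is unseen and
    keeps its original probability. So the expected number of neighbours in a target set chosen by
    the history is a sum of edge probabilities. *)
Lemma sum_new_neighbors_le (C : pred (history n)) (g : history n -> {set 'I_n}) t b :
    0 <= b ->
    (forall h, C h -> [disjoint next h |: g h & queried h]) ->
    (forall h, C h -> \sum_(y in g h) w (next h) * w y / total_weight w <= b) ->
  \sum_(E : {set {set 'I_n}} | E \subset vpairs n)
    chung_lu w E * ((C (tr E t))%:R *
      #|neighbors E (next (tr E t)) :&: g (tr E t)|%:R) <= b.
Proof.
move=> b0 Cq Cb.
pose B x y : pred (history n) := fun h => [&& C h, next h == x & y \in g h].
have BQ x y h : B x y h -> x \notin queried h /\ y \notin queried h.
  case/and3P=> /Cq + /eqP<- yg; rewrite disjoint_subset => /fintype.subsetP sub.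
  by split; apply: sub; rewrite finset.in_setU1 ?eqxx // yg orbT.
(* The same expectation with each edge indicator replaced by its probability. *)
pose S := \sum_(E : {set {set 'I_n}} | E \subset vpairs n) chung_lu w E *
  \sum_(x < n) \sum_(y < n | x != y) w x * w y / total_weight w * (B x y (tr E t))%:R.
apply: (@le_trans _ _ S); last first.
  rewrite -[leRHS](mul1r b) -(sum_chung_lu w) mulr_suml; apply: ler_sum => E _.
  rewrite ler_wpM2l ?chung_lu_ge0 //; set h := tr E t.
  case: (boolP (C h)) => Ch; last first.
    rewrite big1 // => x _; rewrite big1 // => y _.
    by rewrite /B (negbTE Ch) mulr0.
  rewrite (bigD1 (next h)) //= [X in _ + X]big1 ?addr0; last first.
    move=> x xn; rewrite big1 // => y _.
    by rewrite /B eq_sym (negbTE xn) andbF mulr0.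
  apply: le_trans (Cb _ Ch); rewrite big_mkcond [leRHS]big_mkcond /=.
  apply: ler_sum => y _; rewrite /B Ch eqxx /=.
  have p0 : 0 <= w (next h) * w y / total_weight w.
    by rewrite divr_ge0 ?mulr_ge0 // sumr_ge0.
  by case: (y \in g h); case: ifP; rewrite ?mulr1 ?mulr0.
rewrite le_eqVlt; apply/orP; left; apply/eqP.
have -> : S = \sum_(x < n) \sum_(y < n | x != y)
  \sum_(E : {set {set 'I_n}} | E \subset vpairs n)
    chung_lu w E * (([set x; y] \in E)%:R * (B x y (tr E t))%:R).
  rewrite /S; under eq_bigr do rewrite mulr_sumr.
  rewrite exchange_big; apply: eq_bigr => x _ /=.
  under eq_bigr do rewrite mulr_sumr.
  rewrite exchange_big; apply: eq_bigr => y xy /=.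
  rewrite (sum_unseen_edge t xy (BQ x y)) mulr_sumr.
  by apply: eq_bigr => E _; ring.
under [RHS]eq_bigr do rewrite exchange_big /=.
rewrite exchange_big /=; apply: eq_bigr => E EV.
under [RHS]eq_bigr do rewrite -mulr_sumr.
rewrite -mulr_sumr; congr (_ * _); set h := tr E t.
case: (boolP (C h)) => Ch; last first.
  rewrite mul0r big1 // => x _; rewrite big1 // => y _.
  by rewrite /B (negbTE Ch) mulr0.
rewrite (bigD1 (next h)) //= [X in _ + X]big1 ?addr0 ?mul1r; last first.
  move=> x xn; rewrite big1 // => y _.
  by rewrite /B eq_sym (negbTE xn) andbF mulr0.
rewrite -sum1_card natr_sum big_mkcond [RHS]big_mkcond /=.
apply: eq_bigr => y _; rewrite /B Ch eqxx /= finset.in_setI mem_neighbors.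
(* The double sum omits [y = x]; there are no loops, because [E] consists of genuine pairs. *)
case: eqVneq => [<-|_] /=.
  case: ifP => // /andP[/(fintype.subsetP EV)].
  by rewrite pair_in_vpairs eqxx.
by case: (_ \in E); case: (_ \in g h); rewrite /= ?mulr1 ?mulr0.
Qed.

End FixedWeights.
End Steps.

(** * Probability of each way in which a step can fail *)

Section BadSteps.
Set Implicit Arguments.
Unset Strict Implicit.
Variables (R : realType) (n : nat) (A : algorithm R n) (u v : 'I_n) (c : seed A).
Variables (w : 'I_n -> R) (l s : R).
Hypothesis w_ge0 : forall i, 0 <= w i.
Hypothesis w_mul_le : forall i j, w i * w j <= total_weight w.
Hypotheses (l_gt0 : 0 < l) (s_gt0 : 0 < s) (s_sqr : s ^+ 2 = total_weight w).
Implicit Types (E : {set {set 'I_n}}) (h : history n) (t M D : nat) (x y z : 'I_n).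
Implicit Types sigma : 'S_n.

Local Notation tr E t := (transcript E u v c t).
Local Notation next h := (next_query c u v h).
Local Notation disc h := (discovered u v h).
Local Notation W := (total_weight w).

Definition light sigma : {set 'I_n} := [set i | w (sigma i) < l].

Lemma weight_le_sqrt i : w i <= s.
Proof.
rewrite -(@ler_pXn2r _ 2) ?nnegrE ?w_ge0 ?(ltW s_gt0) //.
by rewrite s_sqr expr2 w_mul_le.
Qed.

Lemma total_weight_gt0 : 0 < W.
Proof. by rewrite -s_sqr exprn_gt0. Qed.

Lemma perm_weight_mul_le sigma i j :
  (w \o sigma) i * (w \o sigma) j <= total_weight (w \o sigma).
Proof. by rewrite total_weight_perm /=. Qed.

(** Markov's inequality: a vertex of weight below [l] has at most l W / W = l unqueried neighbours
    on average. *)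
Lemma expect_many_neighbors_le M t : (0 < M)%N ->
  expect w (fun sigma E => [&& next (tr E t) \notin queried (tr E t),
      next (tr E t) \in light sigma
    & (M < #|neighbors E (next (tr E t)) :\: queried (tr E t)|)%N]%:R) <= l / M%:R.
Proof.
move=> M0; have M0' : 0 < M%:R :> R by rewrite ltr0n.
apply: expect_le_fixed => sigma.
pose C h := (next h \notin queried h) && (next h \in light sigma).
rewrite ler_pdivlMr //.
have := @sum_new_neighbors_le _ _ A u v c (w \o sigma) (fun i => w_ge0 _)
  (perm_weight_mul_le sigma) C (fun h => ~: queried h) t l (ltW l_gt0).
move=> H; refine (le_trans _ (H _ _)); last 2 first.
- move=> h /andP[nq _]; rewrite disjoint_subset; apply/fintype.subsetP => x.
  by rewrite finset.in_setU1 => /orP[/eqP->|]; rewrite ?finset.in_setC.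
- move=> h /andP[_]; rewrite inE => lt.
  rewrite total_weight_perm -mulr_suml -mulr_sumr ler_pdivrMr ?total_weight_gt0 //.
  apply: ler_pM; rewrite ?sumr_ge0 ?(ltW lt) //= -(total_weight_perm w sigma).
  rewrite /total_weight [leRHS](bigID (mem (~: queried h))) /= lerDl.
  exact: sumr_ge0.
rewrite mulr_suml; apply: ler_sum => E _; rewrite -mulrA.
rewrite ler_wpM2l ?chung_lu_perm_ge0 // /C; set x := next _.
rewrite andbA; case: ltnP => [ltM|_]; last by rewrite andbF mul0r mulr_ge0.
rewrite andbT -finset.setDE; case: (_ && _); rewrite ?mul0r // !mul1r ler_nat.
exact: ltnW.
Qed.

(** First moment bound: there are at most [D] targets, each joined to a light vertex with
    probability at most l s / s^2, as no weight exceeds [s]. *)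
Lemma expect_collision_le D t :
  expect w (fun sigma E => [&& next (tr E t) \notin queried (tr E t),
      next (tr E t) \in light sigma, (#|disc (tr E t)| <= D)%N
    & ~~ [disjoint neighbors E (next (tr E t)) & disc (tr E t) :\: queried (tr E t)]]%:R)
  <= D%:R * l / s.
Proof.
apply: expect_le_fixed => sigma.
pose C h := [&& next h \notin queried h, next h \in light sigma & (#|disc h| <= D)%N].
have b0 : 0 <= D%:R * l / s by rewrite divr_ge0 ?mulr_ge0 ?(ltW l_gt0) ?(ltW s_gt0).
have := @sum_new_neighbors_le _ _ A u v c (w \o sigma) (fun i => w_ge0 _)
  (perm_weight_mul_le sigma) C (fun h => disc h :\: queried h) t _ b0.
move=> H; refine (le_trans _ (H _ _)); last 2 first.
- move=> h /andP[nq _]; rewrite disjoint_subset; apply/fintype.subsetP => x.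
  by rewrite finset.in_setU1 => /orP[/eqP-> //|]; rewrite finset.in_setD => /andP[].
- move=> h /and3P[_]; rewrite inE => lt dD.
  apply: (@le_trans _ _ (\sum_(y in disc h :\: queried h) l / s)).
    apply: ler_sum => y _; rewrite total_weight_perm -s_sqr expr2 invfM mulrA /=.
    rewrite ler_wpM2r ?invr_ge0 ?(ltW s_gt0) // ler_pdivrMr //.
    by apply: ler_pM; rewrite ?(ltW lt) ?weight_le_sqrt.
  rewrite sumr_const -[leLHS]mulr_natl -[leRHS]mulrA.
  rewrite ler_wpM2r ?divr_ge0 ?(ltW l_gt0) ?(ltW s_gt0) //.
  by rewrite ler_nat (leq_trans _ dD) // subset_leq_card // finset.subsetDl.
apply: ler_sum => E _.
rewrite ler_wpM2l ?chung_lu_perm_ge0 // /C; set x := next _.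
rewrite -setI_eq0 andbA andbA -[X in X && ~~ _]andbA -cards_eq0.
case: (posnP #|_ :&: _|) => [->|I0]; first by rewrite andbF mulr0.
rewrite andbT; case: (_ && _); rewrite ?mul0r // mul1r ler1n.
exact: I0.
Qed.

Definition heavy_weight : R := \sum_(i < n | l <= w i) w i.

(* The next vertex [y] was discovered through a single light parent [x].  For
   an undiscovered [z], exchanging the weights of [y] and [z] multiplies the
   probability of the history by at most 2 w_y / w_z, so that
   [y] is at most about as heavy as a size-biased vertex. *)
Lemma expect_heavy_step_le M D t : 2 * l <= s -> 2 * D%:R <= s ->
  expect w (fun sigma E => [&& explore_ok u v c (light sigma) M E t,
      next (tr E t) \notin queried (tr E t), (#|disc (tr E t)| <= D)%N
    & next (tr E t) \notin light sigma]%:R) <= 4 * heavy_weight / W.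
Proof.
move=> ls Ds.
pose P x y z sigma E := [&& explore_ok u v c (light sigma) M E t,
   (next (tr E t) == y) && (y \notin queried (tr E t)),
   (x \in queried (tr E t)) && (y \in neighbors E x) & z \notin disc (tr E t)].
have P_neq x y z sigma E : P x y z sigma E -> [/\ x != y, x != z & y != z].
  case/and4P=> _ /andP[_ yq] /andP[xq yx] zd.
  split; first by apply: contraNneq yq => <-.
    apply: contraNneq zd => <-; exact: (fintype.subsetP (queried_sub_discovered u v c E t)).
  by apply: contraNneq zd => <-; exact: neighbor_discovered yx.
(* No queried vertex is [y] or [z], and [x] is the only one adjacent to either, so all answers
   survive. The conditions on [u] and [v] are there because [explore_ok] also records the lightness
   of the two endpoints. *)
have P_swap x y z sigma E : P x y z sigma E -> y != u -> y != v ->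
    P x y z (tperm y z * sigma)%g (swap_graph x y z E).
  move=> Pxyz yu yv; have [xy xz yz] := P_neq _ _ _ _ _ Pxyz.
  case/and4P: Pxyz => ok /andP[yn yq] /andP[xq yx] zd.
  have qyz q : q \in queried (tr E t) -> q != y /\ q != z.
    move=> qq; split; first by apply: contraNneq yq => <-.
    by apply: contraNneq zd => <-; exact: (fintype.subsetP (queried_sub_discovered u v c E t)).
  have N q : q \in queried (tr E t) -> neighbors (swap_graph x y z E) q = neighbors E q.
    move=> qq; have [qy qz] := qyz _ qq.
    apply: neighbors_swap_graph => // qx; apply/andP; split.
      apply: contra qx => yq'; apply/eqP; exact: (explore_ok_forest ok yq).
    by apply: contra zd; exact: neighbor_discovered.
  have zu : z != u by apply: contraNneq zd => ->; apply/discoveredP/Or31.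
  have zv : z != v by apply: contraNneq zd => ->; apply/discoveredP/Or32.
  have Lq q : q != y -> q != z ->
      (q \in light (tperm y z * sigma)%g) = (q \in light sigma).
    by move=> qy qz; rewrite !inE permM tpermD // eq_sym.
  apply/and4P; rewrite (eq_transcript N) yn yq xq N // yx zd; split=> //.
  rewrite (eq_explore_ok M N (LS := light sigma)) //; first 2 last.
  - by move=> q /qyz[]; exact: Lq.
  - by rewrite Lq // eq_sym.
  - by rewrite Lq // eq_sym.
(* [F] weighs a heavy next vertex by w_z; the exchange sends it to [G], where [z] carries the old
   weight of [y]. Multiplying by w_z instead of dividing avoids any trouble with zero weights. *)
pose F x y z sigma E := ((P x y z sigma E)%:R * ((l <= w (sigma y))%R%:R * w (sigma z))) : R.
pose G x y z sigma E := ((P x y z sigma E)%:R * ((l <= w (sigma z))%R%:R * (2 * w (sigma z)))) : R.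
have FG x y z : expect w (F x y z) <= expect w (G x y z).
  have G0 sigma E : 0 <= G x y z sigma E by rewrite !mulr_ge0.
  case: (boolP [&& x != y, x != z & y != z]) => [/and3P[xy xz yz]|nxyz]; last first.
    apply: le_expect => // sigma E _; rewrite /F.
    case: (boolP (P _ _ _ _ _)) => [/P_neq[xy xz yz]|_]; last by rewrite mul0r.
    by rewrite xy xz yz in nxyz.
  pose tau := (tperm y z).
  have -> : expect w (G x y z) =
     \sum_(sigma : 'S_n) \sum_(E : {set {set 'I_n}} | E \subset vpairs n)
       (n`!%:R)^-1 * (chung_lu (w \o (tau * sigma)%g) (swap_graph x y z E) *
          G x y z (tau * sigma)%g (swap_graph x y z E)).
    rewrite /expect (reindex_inj (@mulgI _ tau)); apply: eq_bigr => sigma _.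
    rewrite (reindex_inj (inv_inj (swap_graphK xy xz))); apply: eq_bigl => E.
    exact: swap_graph_sub.
  apply: ler_sum => sigma _; apply: ler_sum => E EV.
  rewrite ler_wpM2l ?invr_ge0 ?ler0n // /F.
  case: (boolP (P x y z sigma E)) => [Pxyz|_]; last first.
    by rewrite mul0r mulr0 mulr_ge0 // chung_lu_perm_ge0.
  case: (boolP (l <= w (sigma y))) => [heavy|_]; last first.
    by rewrite !(mul0r, mulr0) mulr_ge0 // chung_lu_perm_ge0.
  rewrite !mul1r.
  case/and4P: (Pxyz) => ok /andP[yn yq] /andP[xq yx] zd.
  have yL : y \notin light sigma by rewrite inE -leNgt.
  have /andP[uL vL] := explore_ok_ends ok.
  have yu : y != u by apply: contraNneq yL => ->.
  have yv : y != v by apply: contraNneq yL => ->.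
  rewrite /G (P_swap x y z sigma E Pxyz yu yv) mul1r !permM tpermR heavy mul1r.
  have -> : chung_lu (w \o (tau * sigma)%g) (swap_graph x y z E) =
      chung_lu ((w \o sigma) \o tau) (swap_graph x y z E).
    by congr (chung_lu _ _); apply/funext => i /=; rewrite permM.
  rewrite mulrC [leRHS]mulrC.
  apply: (chung_lu_swap (w := w \o sigma)) => //.
  - by move=> i /=.
  - exact: perm_weight_mul_le.
  - by rewrite -mem_neighbors.
  - by rewrite -mem_neighbors; apply: contra zd; exact: neighbor_discovered.
  rewrite total_weight_perm -s_sqr expr2 mulrA /=.
  have xl : w (sigma x) < l by have := fintype.subsetP (explore_ok_light ok) _ xq; rewrite inE.
  apply: ler_pM; rewrite ?mulr_ge0 ?weight_le_sqrt //.
  by apply: le_trans ls; rewrite ler_pM2l // ltW.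
(* The bound is squeezed between two sums. On the event, the sum of [F] is at least W / 2, since the
   discovered vertices hold at most D s <= W / 2. The sum of [G] is at most twice the heavy weight,
   since [y] is the next vertex and [x] its unique parent. *)
rewrite ler_pdivlMr ?total_weight_gt0 // mulrC.
have -> : 4 * heavy_weight = 2 * (2 * heavy_weight) by ring.
rewrite -ler_pdivrMl // mulrA -expectZ.
have upper : \sum_x \sum_y \sum_z expect w (G x y z) <= 2 * heavy_weight.
  under eq_bigr do (under eq_bigr do rewrite -expect_sum);
  under eq_bigr do rewrite -expect_sum.
  rewrite -expect_sum -[leRHS](expect_cst w); apply: le_expect => // sigma E _.
  have HE : 2 * heavy_weight = \sum_z ((l <= w (sigma z))%R%:R * (2 * w (sigma z))).
    rewrite /heavy_weight mulr_sumr big_mkcond [LHS](reindex_inj (@perm_inj _ sigma)).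
    by apply: eq_bigr => z _; case: ifP; rewrite ?mul1r ?mul0r.
  have H0 : 0 <= 2 * heavy_weight by rewrite mulr_ge0 // sumr_ge0.
  set y := next (tr E t).
  case: (pickP (fun x => (x \in queried (tr E t)) && (y \in neighbors E x))) => [x0|no]; last first.
    rewrite big1 // => x _; rewrite big1 // => y' _; rewrite big1 // => z _.
    rewrite /G; case: (boolP (P _ _ _ _ _)) => [|_]; last by rewrite mul0r.
    by case/and4P=> _ /andP[/eqP yE _]; rewrite -yE no.
  case/andP=> x0q yx0.
  rewrite (bigD1 x0) //= [X in _ + X]big1 ?addr0; last first.
    move=> x xx0; rewrite big1 // => y' _; rewrite big1 // => z _.
    rewrite /G; case: (boolP (P _ _ _ _ _)) => [|_]; last by rewrite mul0r.
    case/and4P=> ok /andP[/eqP yE yq] /andP[xq yx] _; rewrite -yE in yq yx.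
    by rewrite (explore_ok_forest ok yq x0q xq yx0 yx) eqxx in xx0.
  rewrite (bigD1 y) //= [X in _ + X]big1 ?addr0; last first.
    move=> y' yy'; rewrite big1 // => z _.
    rewrite /G; case: (boolP (P _ _ _ _ _)) => [|_]; last by rewrite mul0r.
    by case/and4P=> ok /andP[/eqP yE _]; rewrite -yE eqxx in yy'.
  rewrite HE; apply: ler_sum => z _; rewrite /G.
  by case: (P _ _ _ _ _); rewrite ?mul1r // mul0r mulr_ge0 // mulr_ge0.
apply: (le_trans _ upper).
apply: (@le_trans _ _ (\sum_x \sum_y \sum_z expect w (F x y z))); last first.
  by do 3!(apply: ler_sum => ? _).
under [leRHS]eq_bigr do (under eq_bigr do rewrite -expect_sum);
under [leRHS]eq_bigr do rewrite -expect_sum.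
rewrite -expect_sum; apply: le_expect => // sigma E _.
have F0 x y z : 0 <= F x y z sigma E by rewrite !mulr_ge0.
case: (boolP (explore_ok u v c (light sigma) M E t && _)) => [|_]; last first.
  by rewrite mulr0; do 3!(apply: sumr_ge0 => ? _).
case/and4P=> ok nq dD nL; rewrite mulr1.
set y := next (tr E t) in nq nL *.
have [x0 x0q yx0] : exists2 x, x \in queried (tr E t) & y \in neighbors E x.
  have /andP[uL vL] := explore_ok_ends ok.
  have : y \in disc (tr E t) by exact: next_query_discovered.
  by case/discoveredP => // yE; rewrite yE ?uL ?vL in nL.
rewrite (bigD1 x0) //= -[leLHS]addr0 lerD //; last by do 3!(apply: sumr_ge0 => ? _).
rewrite (bigD1 y) //= -[leLHS]addr0 lerD //; last by do 2!(apply: sumr_ge0 => ? _).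
have FE z : F x0 y z sigma E = if z \notin disc (tr E t) then w (sigma z) else 0.
  rewrite /F /P ok eqxx nq x0q yx0 /= leNgt; rewrite inE in nL.
  by rewrite nL mul1r; case: (z \notin _); rewrite ?mul1r ?mul0r.
under eq_bigr do rewrite FE.
rewrite -big_mkcond /=.
have := total_weight_perm w sigma.
rewrite {1}/total_weight (bigID (mem (disc (tr E t)))) /= => WE.
have dW : \sum_(i in disc (tr E t)) w (sigma i) <= D%:R * s.
  apply: (@le_trans _ _ (\sum_(i in disc (tr E t)) s)).
    by apply: ler_sum => i _; exact: weight_le_sqrt.
  by rewrite sumr_const -[leLHS]mulr_natl ler_wpM2r ?ler_nat ?(ltW s_gt0).
have : 2 * (D%:R * s) <= W by rewrite mulrA -s_sqr expr2 ler_wpM2r // ltW.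
by move: WE dW; lra.
Qed.

End BadSteps.

(** * Union bound over the queries *)

Section Search.
Set Implicit Arguments.
Unset Strict Implicit.
Variables (R : realType) (n : nat) (A : algorithm R n).
Variables (w : 'I_n -> R).
Hypothesis w_ge0 : forall i, 0 <= w i.
Hypothesis w_mul_le : forall i j, w i * w j <= total_weight w.
Implicit Types (E : {set {set 'I_n}}) (u v : 'I_n) (c : seed A).

(** The first term pays for a heavy endpoint; each later step can first fail in three ways: a heavy
    query, too many new neighbours, or a collision. *)
Lemma expect_explore_fails_le u v c (l s : R) (M T : nat) :
    0 < l -> 0 < s -> s ^+ 2 = total_weight w -> (0 < M)%N ->
    2 * l <= s -> 2 * (2 + T * M)%:R <= s ->
  expect w (fun sigma E => (~~ explore_ok u v c (light w l sigma) M E T)%:R) <=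
    2 * (total_weight w / n%:R / l) +
    T%:R * (4 * heavy_weight w l / total_weight w + l / M%:R + (2 + T * M)%:R * l / s).
Proof.
move=> l0 s0 sW M0 ls Ds; set b := _ + _ / s.
suff H t : (t <= T)%N ->
    expect w (fun sigma E => (~~ explore_ok u v c (light w l sigma) M E t)%:R) <=
    2 * (total_weight w / n%:R / l) + t%:R * b by exact: H.
elim: t => [_|t IH tT] /=.
  rewrite mul0r addr0 mulr_natl mulr2n.
  apply: (le_trans _ (lerD (expect_heavy_le w_ge0 w_mul_le u l0)
                           (expect_heavy_le w_ge0 w_mul_le v l0))).
  rewrite -expectD; apply: le_expect => // sigma E _.
  rewrite !inE negb_and -!leNgt -natrD ler_nat.
  by case: (l <= _); case: (l <= _).
have DT : (2 + t * M <= 2 + T * M)%N by rewrite leq_add2l leq_mul2r (ltnW tT) orbT.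
have e1 := expect_heavy_step_le u v c w_ge0 w_mul_le s0 sW M t ls Ds.
have e2 := expect_many_neighbors_le u v c w_ge0 w_mul_le l0 s0 sW t M0.
have e3 := expect_collision_le u v c w_ge0 w_mul_le l0 s0 sW (2 + T * M) t.
have step := lerD (IH (ltnW tT)) (lerD (lerD e1 e2) e3).
have -> : t.+1%:R * b = t%:R * b + b by rewrite -natr1 mulrDl mul1r.
rewrite addrA.
apply: (le_trans _ step).
rewrite -!expectD; apply: le_expect => // sigma E _.
rewrite -!natrD ler_nat; set L := light w l sigma; set h := transcript _ _ _ _ _.
rewrite negb_and; case: (boolP (explore_ok _ _ _ _ _ _ _)) => //= ok.
rewrite /step_ok (leq_trans (card_discovered ok) DT) /= -/h.
case: (_ \in queried h) => //=.
case: (_ \in L) => //=; rewrite !add0n ltnNge.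
by case: (#|_| <= M)%N => //=; rewrite ?add0n ?leq_addr.
Qed.

Lemma query_prob_expect (event : {set {set 'I_n}} -> 'I_n -> 'I_n -> seed A -> Prop) :
  query_prob w event = \sum_(u < n) \sum_(v < n | u != v) \sum_c
    (n * n.-1)%:R^-1 * seed_law c * expect w (fun _ E => `[< event E u v c >]%:R).
Proof.
rewrite /query_prob /expect.
under eq_bigr => s _ do rewrite exchange_big /=.
rewrite exchange_big /=; apply: eq_bigr => u _.
under eq_bigr => s _ do rewrite exchange_big /=.
rewrite exchange_big /=; apply: eq_bigr => v uv.
under eq_bigr => s _ do (under eq_bigr => E _ do rewrite big_mkcond /=).
under eq_bigr => s _ do rewrite exchange_big /=.
rewrite exchange_big /=; apply: eq_bigr => c _.
rewrite mulr_sumr; apply: eq_bigr => s _; rewrite mulr_sumr; apply: eq_bigr => E _.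
by case: asboolP => _; rewrite /= ?mulr1 ?mulr0 //; ring.
Qed.

Lemma sum_pair_seed : (1 < n)%N ->
  \sum_(u < n) \sum_(v < n | u != v) \sum_(c : seed A)
    (n * n.-1)%:R^-1 * seed_law c = 1 :> R.
Proof.
move=> n1; have N0 : (n * n.-1)%:R != 0 :> R.
  by rewrite pnatr_eq0 muln_eq0 negb_or -!lt0n (ltnW n1) ltn_predRL.
under eq_bigr do (under eq_bigr do rewrite -mulr_sumr seed_law_sum1 mulr1).
under eq_bigr => u _.
  rewrite sumr_const (_ : #|_| = n.-1); last first.
    rewrite -[n in RHS](card_ord n) -(cardC1 u).
    by apply: eq_card => v; rewrite !inE eq_sym.
  over.
by rewrite sumr_const card_ord -mulrnA -[LHS]mulr_natr [(n.-1 * n)%N]mulnC mulVf.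
Qed.

(** The random naming already makes fixed endpoints uniform among the vertices, so averaging over
    endpoints and seeds asks only for a bound uniform in them. *)
Lemma query_prob_bounds (event : {set {set 'I_n}} -> 'I_n -> 'I_n -> seed A -> Prop) b :
    (1 < n)%N ->
    (forall u v c, u != v -> expect w (fun _ E => (~~ `[< event E u v c >])%:R) <= b) ->
  1 - b <= query_prob w event <= 1.
Proof.
move=> n1 eb; rewrite query_prob_expect.
have compl u v c : expect w (fun _ E => `[< event E u v c >]%:R) =
    1 - expect w (fun _ E => (~~ `[< event E u v c >])%:R).
  apply/eqP; rewrite eq_sym subr_eq -expectD; apply/eqP; rewrite -[LHS](expect_cst w).
  apply: eq_bigr => s _; apply: eq_bigr => E _.
  by case: asboolP; rewrite /= ?addr0 ?add0r.
have p0 c : 0 <= (n * n.-1)%:R^-1 * seed_law c.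
  by rewrite mulr_ge0 ?invr_ge0 // seed_law_ge0.
apply/andP; split.
  rewrite -[leLHS]mul1r -[X in X * _ <= _](sum_pair_seed n1) mulr_suml.
  apply: ler_sum => u _; rewrite mulr_suml; apply: ler_sum => v uv.
  rewrite mulr_suml; apply: ler_sum => c _.
  by rewrite ler_wpM2l // compl lerD2l lerN2 eb.
rewrite -[leRHS](sum_pair_seed n1); do 3!(apply: ler_sum => ? _).
rewrite ler_piMr // -[leRHS](expect_cst w); apply: le_expect => // s E _.
by rewrite lern1 leq_b1.
Qed.

Lemma path_found_le E u v c (L : {set 'I_n}) (M q T : nat) : u != v -> (q <= T)%N ->
  explore_ok u v c L M E T -> ~~ path_found E u v c q.
Proof. by move=> uv qT /(explore_ok_le qT); exact: explore_ok_separated. Qed.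

Lemma query_prob_search_bounds (x l s : R) (M T : nat) :
    (1 < n)%N -> x <= T.+1%:R ->
    0 < l -> 0 < s -> s ^+ 2 = total_weight w -> (0 < M)%N ->
    2 * l <= s -> 2 * (2 + T * M)%:R <= s ->
  1 - (2 * (total_weight w / n%:R / l) +
    T%:R * (4 * heavy_weight w l / total_weight w + l / M%:R + (2 + T * M)%:R * l / s))
  <= query_prob w (fun E u v c => forall q, path_found E u v c q -> x <= q%:R) (A := A) <= 1.
Proof.
move=> n1 xT l0 s0 sW M0 ls Ds; apply: query_prob_bounds => // u v c uv.
apply: le_trans (expect_explore_fails_le u v c l0 s0 sW M0 ls Ds).
apply: le_expect => // sigma E _; rewrite ler_nat.
case: asboolP => //= nev; case: (boolP (explore_ok _ _ _ _ _ _ _)) => // ok.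
(* A good exploration rules out [q <= T], whence [T.+1] rather than [T] in the hypothesis on [x]. *)
exfalso; apply: nev => q; case: (leqP q T) => [qT|Tq].
  by rewrite (negbTE (path_found_le uv qT ok)).
by move=> _; apply: le_trans xT _; rewrite ler_nat.
Qed.

End Search.

(** * Total weight of the heavy vertices under a power law *)

Section PowerLawTail.
Set Implicit Arguments.
Unset Strict Implicit.
Variables (R : realType) (beta : R).
Hypothesis beta_gt2 : 2 < beta.

Lemma powRN_le (x y a : R) : 0 <= a -> 0 < x -> x <= y -> y `^ (- a) <= x `^ (- a).
Proof.
move=> a0 x0 xy; rewrite !powRN lef_pV2 ?posrE ?powR_gt0 //; last exact: lt_le_trans xy.
by apply: ge0_ler_powR; rewrite ?nnegrE ?(ltW x0) // (le_trans _ xy) ?ltW.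
Qed.

Lemma sum_powR_dyadic_le p : (0 < p)%N ->
  \sum_(p <= m < p.*2) m%:R `^ (- beta) <= (p%:R : R) `^ (1 - beta).
Proof.
move=> p0; have p0' : 0 < p%:R :> R by rewrite ltr0n.
apply: (@le_trans _ _ (\sum_(p <= m < p.*2) (p%:R : R) `^ (- beta))).
  rewrite !big_nat; apply: ler_sum => m /andP[pm _].
  by rewrite powRN_le ?ler_nat // ltW // (lt_trans _ beta_gt2).
rewrite sumr_const_nat -addnn addnK -[leLHS]mulr_natl powRD ?powRr1 ?(ltW p0') //.
by rewrite (gt_eqF p0') implybT.
Qed.

Variables (n : nat) (w : 'I_n -> R) (C r a s : R) (K : nat).
Hypothesis n_gt0 : (0 < n)%N.
Hypothesis w_le : forall i, w i <= s.
Hypotheses (C_gt0 : 0 < C) (r_ge0 : 0 <= r) (a_gt0 : 0 < a) (s_ge0 : 0 <= s).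
Hypothesis upper : forall p q : nat, (K <= p < q)%N -> window_fraction w p q <=
  C * (a * \sum_(p <= m < q) m%:R `^ (- beta)) + r / n%:R.

Lemma window_weight_le p : (0 < p)%N -> (K <= p)%N ->
  \sum_(i < n | p%:R <= w i < p.*2%:R) w i <=
    2 * n%:R * C * a * p%:R `^ (2 - beta) + 2 * r * s.
Proof.
move=> p0 Kp; have p0' : 0 < p%:R :> R by rewrite ltr0n.
have n0' : 0 < n%:R :> R by rewrite ltr0n.
have rhs0 : 0 <= 2 * n%:R * C * a * p%:R `^ (2 - beta) + 2 * r * s.
  by rewrite addr_ge0 ?mulr_ge0 ?powR_ge0 ?(ltW C_gt0) ?(ltW a_gt0).
(* A nonempty window forces [p <= s], which controls the weight 2 p r of the rounding vertices. *)
case: (pickP (fun i => p%:R <= w i < p.*2%:R)) => [i0 /andP[pi0 _]|no]; last first.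
  by rewrite big_pred0.
have ps : p%:R <= s by exact: le_trans (w_le i0).
pose N : R := #|[set i | p%:R <= w i < p.*2%:R]|%:R.
have sumN : \sum_(i < n | p%:R <= w i < p.*2%:R) w i <= N * (2 * p%:R).
  apply: (@le_trans _ _ (\sum_(i < n | p%:R <= w i < p.*2%:R) (2 * p%:R))).
    by apply: ler_sum => i /andP[_ /ltW]; rewrite -muln2 natrM mulrC.
  rewrite sumr_const -[leLHS]mulr_natl /N.
  by rewrite le_eqVlt; apply/orP; left; apply/eqP; congr (_%:R * _); rewrite cardsE.
have p2 : (p < p.*2)%N by rewrite -addnn -{1}[p]addn0 ltn_add2l.
have := upper (p := p) (q := p.*2); rewrite Kp p2 => /(_ isT).
rewrite /window_fraction -/N ler_pdivrMr // mulrDl -[r / _ * _]mulrA mulVf ?gt_eqF // mulr1.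
move=> Nle; apply: (le_trans sumN).
have N1 : N <= n%:R * C * a * p%:R `^ (1 - beta) + r.
  apply: (le_trans Nle); rewrite lerD2r.
  rewrite [leLHS]mulrC !mulrA ler_wpM2l ?sum_powR_dyadic_le //.
  by rewrite !mulr_ge0 ?(ltW C_gt0) ?(ltW a_gt0).
apply: (@le_trans _ _ ((n%:R * C * a * p%:R `^ (1 - beta) + r) * (2 * p%:R))).
  by rewrite ler_wpM2r // mulr_ge0.
rewrite mulrDl; apply: lerD; last first.
  by move: (ler_wpM2l r_ge0 ps); lra.
have -> : 2 - beta = 1 + (1 - beta) by ring.
rewrite (powRD (r := 1) (s := 1 - beta)) ?powRr1 ?ler0n ?(gt_eqF p0') ?implybT //.
by rewrite le_eqVlt; apply/orP; left; apply/eqP; ring.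
Qed.

(** As 2 - beta < 0, every dyadic window is bounded like the first one. This costs a factor [J],
    later taken logarithmic in [n]. *)
Lemma heavy_weight_dyadic_le k J : (0 < k)%N -> (K <= k)%N ->
    (forall i, w i < (k * 2 ^ J)%:R) ->
  heavy_weight w k%:R <=
    J%:R * (2 * n%:R * C * a * k%:R `^ (2 - beta) + 2 * r * s).
Proof.
move=> k0 Kk wJ; set b := _ + _ * s.
have -> : heavy_weight w k%:R = \sum_(i < n | k%:R <= w i < (k * 2 ^ J)%:R) w i.
  by apply: eq_bigl => i; rewrite wJ andbT.
elim: J {wJ} => [|J IH].
  by rewrite expn0 muln1 mul0r big_pred0 // => i; apply/negP => /andP[/le_lt_trans H /H]; rewrite ltxx.
have kJ : (k <= k * 2 ^ J)%N by rewrite leq_pmulr // expn_gt0.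
rewrite (bigID (fun i => w i < (k * 2 ^ J)%:R)) /= -natr1 mulrDl mul1r.
apply: lerD.
  apply: le_trans IH; rewrite le_eqVlt; apply/orP; left; apply/eqP; apply: eq_bigl => i.
  case: (ltP (w i) (k * 2 ^ J)%:R) => [lt|_]; rewrite ?andbF // !andbT.
  by rewrite (lt_le_trans lt) ?andbT // ler_nat leq_pmul2l // leq_exp2l.
apply: (@le_trans _ _ (2 * n%:R * C * a * (k * 2 ^ J)%:R `^ (2 - beta) + 2 * r * s)).
  apply: le_trans (window_weight_le _ _); last 2 first.
  - by rewrite muln_gt0 k0 expn_gt0.
  - exact: leq_trans kJ.
  rewrite le_eqVlt; apply/orP; left; apply/eqP; apply: eq_bigl => i.
  rewrite -leNgt -mul2n mulnCA -expnS.
  case: (leP (k * 2 ^ J)%:R (w i)) => [le|_]; rewrite ?andbF // andbT.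
  by rewrite (le_trans _ le) // ler_nat.
rewrite lerD2r ler_wpM2l ?mulr_ge0 ?(ltW C_gt0) ?(ltW a_gt0) //.
have -> : 2 - beta = - (beta - 2) by ring.
by apply: powRN_le; rewrite ?subr_ge0 ?(ltW beta_gt2) ?ltr0n ?ler_nat.
Qed.

Hypothesis K_gt0 : (0 < K)%N.
Hypothesis lower : forall p q : nat, (K <= p < q)%N -> (exists i, q%:R <= w i) ->
  C^-1 * (a * \sum_(p <= m < q) m%:R `^ (- beta)) - r / n%:R <= window_fraction w p q.

(** The lower half of the power law on the single value [K], against the trivial bound 1 on a
    fraction, keeps [a] under control. *)
Lemma normalization_le : (exists i, K.+1%:R <= w i) -> a <= C * (1 + r) * K%:R `^ beta.
Proof.
move=> ex; have := lower (p := K) (q := K.+1); rewrite leqnn ltnSn => /(_ isT ex).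
rewrite big_nat1 => low.
have f1 : window_fraction w K K.+1 <= 1.
  by rewrite ler_pdivrMr ?ltr0n // mul1r ler_nat -[X in (_ <= X)%N]card_ord max_card.
have r1 : r / n%:R <= r by rewrite ler_pdivrMr ?ltr0n // ler_peMr // ler1n.
have : C^-1 * (a * K%:R `^ (- beta)) <= 1 + r by move: low f1 r1; lra.
rewrite ler_pdivrMl // powRN -ler_pdivlMr ?invr_gt0 ?powR_gt0 ?ltr0n //.
by rewrite invrK.
Qed.

Lemma heavy_weight_le k J : (K < k)%N -> (forall i, w i < (k * 2 ^ J)%:R) ->
  heavy_weight w k%:R <=
    J%:R * (2 * n%:R * C * (C * (1 + r) * K%:R `^ beta) * k%:R `^ (2 - beta) + 2 * r * s).
Proof.
move=> Kk wJ; have k0 : (0 < k)%N by exact: leq_ltn_trans Kk.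
have [ex|nex] := pselect (exists i, K.+1%:R <= w i).
  apply: (le_trans (heavy_weight_dyadic_le k0 (ltnW Kk) wJ)).
  rewrite ler_wpM2l // lerD2r ler_wpM2r ?powR_ge0 // ler_wpM2l ?normalization_le //.
  by rewrite !mulr_ge0 ?(ltW C_gt0).
rewrite /heavy_weight big_pred0.
  by rewrite mulr_ge0 // addr_ge0 // !mulr_ge0 ?powR_ge0 ?(ltW C_gt0) ?addr_ge0.
move=> i; apply/negP => kw; apply: nex; exists i; apply: le_trans kw.
by rewrite ler_nat.
Qed.

End PowerLawTail.

(** * Comparisons with small powers of [n] *)

Section Asymptotics.
Set Implicit Arguments.
Unset Strict Implicit.
Variable R : realType.

Lemma near_le_powR (c e : R) : 0 < e -> \forall n \near \oo%classic, c <= n%:R `^ e.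
Proof.
move=> e0; near=> n.
have cn : Num.max c 1 `^ e^-1 <= n%:R by near: n; exact: nbhs_infty_ger.
have c1 : c <= Num.max c 1 by rewrite le_max lexx.
have m0 : 0 <= Num.max c 1 by rewrite le_max ler01 orbT.
rewrite (le_trans c1) // -[leLHS]powRr1 // -[X in _ `^ X](mulVf (lt0r_neq0 e0)) powRrM.
by apply: ge0_ler_powR; rewrite ?nnegrE ?powR_ge0 ?(ltW e0).
Unshelve. all: by end_near. Qed.

Lemma subpolynomial_bounds (f : nat -> R) (e : R) : subpolynomial f -> 0 < e ->
  \forall n \near \oo%classic, n%:R `^ (- e) <= f n <= n%:R `^ e.
Proof.
case=> g g0 fg e0; near=> n.
have -> : f n = n%:R `^ g n by near: n.
have n1 : 1 <= n%:R :> R by near: n; exact: nbhs_infty_ger.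
have : `|g n| <= e by near: n; exact: (cvgr0_norm_le _ g0).
by rewrite ler_norml => /andP[ge ge']; rewrite !ler_powR.
Unshelve. all: by end_near. Qed.

Lemma trunc_log_le_powR (e : R) : 0 < e ->
  \forall n \near \oo%classic, (trunc_log 2 n).+1%:R <= n%:R `^ e.
Proof.
move=> e0; have h0 : 0 < e / 2 by rewrite divr_gt0.
have l2 : 0 < ln 2 :> R by rewrite ln_gt0 // ltr1n.
(* Half of the exponent dominates the logarithm through ln y <= y with y = n^(e/2); the other half
   absorbs the constant. *)
pose c : R := (e / 2 * ln 2)^-1.
have c0 : 0 < c by rewrite invr_gt0 mulr_gt0.
near=> n.
have n1 : 1 <= n%:R :> R by near: n; exact: nbhs_infty_ger.
have n0 : (0 < n)%N by move: n1; rewrite ler1n.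
have cn : c + 1 <= n%:R `^ (e / 2) by near: n; exact: near_le_powR.
set m := trunc_log 2 n; set y : R := n%:R `^ (e / 2) in cn *.
have y0 : 0 < y by rewrite powR_gt0 // ltr0n.
have y1 : 1 <= y by move: cn c0; lra.
have my : m%:R * (e / 2 * ln 2) <= y.
  apply: (le_trans _ (ltW (ln_sublinear y0))); rewrite ln_powR mulrCA ler_wpM2l ?(ltW h0) //.
  rewrite mulr_natl -lnXn // ler_ln ?posrE ?exprn_gt0 ?ltr0n // -natrX ler_nat.
  exact: trunc_logP.
have mc : m%:R <= c * y by rewrite /c mulrC ler_pdivlMr // mulr_gt0.
have -> : n%:R `^ e = y * y.
  by rewrite -powRD ?(gt_eqF (lt_le_trans ltr01 n1)) ?implybT // -splitr.
rewrite -natr1; apply: (@le_trans _ _ ((c + 1) * y)); last by rewrite ler_wpM2r // ltW.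
by rewrite mulrDl mul1r lerD.
Unshelve. all: by end_near. Qed.

End Asymptotics.

(** * Choice of parameters and conclusion *)

Section Main.
Set Implicit Arguments.
Unset Strict Implicit.
Variables (R : realType) (beta : R).
Hypothesis hbeta : 2 < beta < 3.

(* [e] absorbs every subpolynomial factor of the union bound; the queried
   vertices are light if their weight is below k ~ n^(1/8), a query may reveal
   at most M ~ n^(1/4) new vertices, and T ~ n^(10 e) queries are allowed. *)
Lemma query_prob_near_one (n : nat) (w : 'I_n -> R) (A : algorithm R n)
    (C r a : R) (K J : nat) (e := (beta - 2) / 320) :
    (1 < n)%N -> expected_degrees w ->
    n%:R `^ (- e) <= avg_weight w <= n%:R `^ e ->
    0 < C -> 0 <= r -> 0 < a -> (0 < K)%N -> K%:R <= n%:R `^ e ->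
    (n <= 2 ^ J)%N -> J%:R <= n%:R `^ e ->
    3 <= n%:R `^ e -> 8 * C * C * (1 + r) <= n%:R `^ e -> 8 * r <= n%:R `^ e ->
    (forall p q : nat, (K <= p < q)%N ->
      let mass := a * \sum_(p <= m < q) m%:R `^ (- beta) in
      window_fraction w p q <= C * mass + r / n%:R /\
      ((exists i, q%:R <= w i) -> C^-1 * mass - r / n%:R <= window_fraction w p q)) ->
  1 - 5 * n%:R `^ (- e) <= query_prob w (A := A) (fun E u v c =>
      forall q : nat, path_found E u v c q -> n%:R `^ ((beta - 2) / 32) <= q%:R :> R) <= 1.
Proof.
move=> n1 [w0 _ wM] /andP[dlo dhi] C0 r0 a0 K0 Ke nJ Je e3 e8C e8r pl.
have [b2 b3] := andP hbeta.
have e0 : 0 < e by rewrite divr_gt0 // subr_gt0.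
have e320 : 320 * e < 1 by rewrite /e; lra.
have thE : beta - 2 = 320 * e by rewrite /e; field.
have bE : beta = 2 + 320 * e by rewrite -thE; ring.
have -> : (beta - 2) / 32 = 10 * e by rewrite thE; field.
clearbody e; clear thE.
have X1 : 1 <= n%:R :> R by rewrite ler1n ltnW.
have X0 : 0 < n%:R :> R by exact: lt_le_trans X1.
pose N x : R := n%:R `^ x.
have N0 x : 0 < N x by exact: powR_gt0.
have N0' x : 0 <= N x by exact: ltW.
have NM x y : N x * N y = N (x + y).
  by rewrite /N powRD // (gt_eqF X0) implybT.
have NV x : (N x)^-1 = N (- x) by rewrite /N powRN.
have Nle x y : x <= y -> N x <= N y by exact: ler_powR.
have N1 : N 1 = n%:R by rewrite /N powRr1 // ltW.
rewrite -/(N e) -/(N (- e)) in dlo dhi Ke Je e3 e8C e8r *; rewrite -/(N (10 * e)).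
have e2 : 2 <= N e by apply: le_trans e3; rewrite ler_nat.
(* Rounding a power of [n] down to a natural number loses at most a factor 2, which n^e absorbs. *)
have truncN x : 0 <= x -> exists k : nat,
    [/\ (0 < k)%N, k%:R <= N x, N (x - e) <= k%:R & N x <= k.+1%:R].
  move=> x0; have Nx1 : 1 <= N x.
    by rewrite -(powRr0 (n%:R : R)); exact: Nle.
  have /andP[lo hi] := truncn_itv (N0' x); exists (Num.truncn (N x)).
  have k0 : (0 < Num.truncn (N x))%N by rewrite truncn_gt0.
  split=> //; last exact: ltW.
  rewrite -NM -NV ler_pdivrMr //; apply: (le_trans (ltW hi)).
  apply: (@le_trans _ _ ((Num.truncn (N x))%:R * 2)).
    by rewrite -natrM ler_nat muln2 -addnn -addn1 leq_add2l.
  by rewrite ler_wpM2l.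
have [k [k0 khi klo _]] : exists k : nat, [/\ (0 < k)%N, k%:R <= N (1 / 8),
    N (1 / 8 - e) <= k%:R & N (1 / 8) <= k.+1%:R] by apply: truncN; lra.
have [M [M0 Mhi Mlo _]] : exists k : nat, [/\ (0 < k)%N, k%:R <= N (1 / 4),
    N (1 / 4 - e) <= k%:R & N (1 / 4) <= k.+1%:R] by apply: truncN; lra.
have [T [T0 Thi _ TS]] : exists k : nat, [/\ (0 < k)%N, k%:R <= N (10 * e),
    N (10 * e - e) <= k%:R & N (10 * e) <= k.+1%:R] by apply: truncN; lra.
have k0' : 0 < k%:R :> R by rewrite ltr0n.
have M0' : 0 < M%:R :> R by rewrite ltr0n.
have K0' : 0 < K%:R :> R by rewrite ltr0n.
set d := avg_weight w in dlo dhi.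
have d0 : 0 < d by exact: lt_le_trans dlo.
have WE : total_weight w = d * n%:R.
  by rewrite /d /avg_weight mulfVK // gt_eqF.
pose s : R := Num.sqrt (total_weight w).
have W0 : 0 < total_weight w by rewrite WE mulr_gt0.
have s0 : 0 < s by rewrite sqrtr_gt0.
have sW : s ^+ 2 = total_weight w by rewrite sqr_sqrtr // ltW.
have slo : N (1 / 2 - e) <= s.
  rewrite -(@ler_pXn2r _ 2) ?nnegrE ?N0' ?(ltW s0) // sW WE.
  rewrite expr2 NM; apply: (@le_trans _ _ (N (- e) * N 1)).
    by rewrite NM; apply: Nle; lra.
  by rewrite N1 ler_wpM2r // ltW.
have shi : s <= n%:R.
  rewrite -(@ler_pXn2r _ 2) ?nnegrE ?(ltW X0) ?(ltW s0) // sW WE.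
  rewrite expr2 ler_wpM2r ?(ltW X0) // (le_trans dhi) // -N1; apply: Nle; lra.
have ws i : w i <= s by exact: weight_le_sqrt.
have sV : s^-1 <= N (e - 1 / 2).
  by rewrite -opprB -NV lef_pV2 ?posrE.
have dV : d^-1 <= N e by rewrite -[e]opprK -NV lef_pV2 ?posrE.
have kV : k%:R^-1 <= N (e - 1 / 8) by rewrite -opprB -NV lef_pV2 ?posrE.
have MV : M%:R^-1 <= N (e - 1 / 4) by rewrite -opprB -NV lef_pV2 ?posrE.
have le_mul x1 y1 x2 y2 : 0 <= x1 -> 0 <= x2 -> x1 <= N y1 -> x2 <= N y2 ->
    x1 * x2 <= N (y1 + y2).
  by move=> ? ? ? ?; rewrite -NM; exact: ler_pM.
have DN : (2 + T * M)%:R <= N (e + (10 * e + 1 / 4)).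
  apply: (@le_trans _ _ (3 * (T%:R * M%:R))).
    rewrite -!natrM ler_nat (_ : 3 = 2 + 1)%N // mulnDl mul1n leq_add2r.
    by rewrite leq_pmulr // muln_gt0 T0.
  by apply: (le_mul _ _ _ _); rewrite ?mulr_ge0 //; apply: (le_mul _ _ _ _).
have ks : 2 * k%:R <= s.
  apply: le_trans slo; apply: (@le_trans _ _ (N (e + 1 / 8))).
    exact: le_mul.
  by apply: Nle; lra.
have Ds : 2 * (2 + T * M)%:R <= s.
  apply: le_trans slo; apply: (@le_trans _ _ (N (e + (e + (10 * e + 1 / 4))))).
    exact: le_mul.
  by apply: Nle; lra.
have Kk : (K < k)%N.
  rewrite -(ler_nat R); apply: (@le_trans _ _ (2 * K%:R)).
    by rewrite -natrM ler_nat mul2n -addnn -addn1 leq_add2l.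
  apply: le_trans klo; apply: (@le_trans _ _ (N (e + e))); first exact: le_mul (ltW K0') _ _.
  by apply: Nle; lra.
have wJ i : w i < (k * 2 ^ J)%:R.
  apply: (le_lt_trans (ws i)); apply: (le_lt_trans shi); rewrite ltr_nat.
  apply: (leq_ltn_trans nJ); rewrite ltn_Pmull ?expn_gt0 //.
  exact: leq_ltn_trans Kk.
have upper p q (pq : (K <= p < q)%N) := (pl p q pq).1.
have lower p q (pq : (K <= p < q)%N) := (pl p q pq).2.
have H := heavy_weight_le b2 (ltnW n1) ws C0 r0 a0 (ltW s0) upper K0 lower Kk wJ.
have KB : K%:R `^ beta <= N (3 * e).
  apply: (@le_trans _ _ (N e `^ beta)).
    by apply: ge0_ler_powR; rewrite ?nnegrE //; lra.
  by rewrite /N -powRrM -/(N _); apply: Nle; nra.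
(* Origin of 320: k ~ n^(1/8) gives the exponent -320 e / 8 = -40 e. Rounding [k] adds 320 e^2 < e,
   and the gain n^(-39 e) outweighs [T] and all subpolynomial factors. *)
have kB : k%:R `^ (2 - beta) <= N (- 39 * e).
  rewrite (_ : 2 - beta = - (320 * e)); last by rewrite bE; ring.
  apply: (@le_trans _ _ (N (1 / 8 - e) `^ (- (320 * e)))).
    by apply: powRN_le => //; lra.
  by rewrite /N -powRrM -/(N _); apply: Nle; nra.
have t2 : 4 * heavy_weight w k%:R / total_weight w <=
    N (- 33 * e) + N (3 * e - 1 / 2).
  have -> : 4 * heavy_weight w k%:R / total_weight w =
      4 / total_weight w * heavy_weight w k%:R by rewrite mulrAC.
  apply: (@le_trans _ _ (4 / total_weight w * (J%:R * (2 * n%:R * C *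
      (C * (1 + r) * K%:R `^ beta) * k%:R `^ (2 - beta) + 2 * r * s)))).
    by rewrite ler_wpM2l ?divr_ge0 ?(ltW W0).
  have -> : 4 / total_weight w * (J%:R * (2 * n%:R * C *
      (C * (1 + r) * K%:R `^ beta) * k%:R `^ (2 - beta) + 2 * r * s)) =
    J%:R * (8 * C * C * (1 + r) * (K%:R `^ beta * (k%:R `^ (2 - beta) * d^-1))) +
    J%:R * (8 * r * s^-1).
    rewrite (_ : 8 * r * s^-1 = 8 * r * s / total_weight w); last first.
      by rewrite -sW; field; rewrite gt_eqF.
    by rewrite WE; field; rewrite !gt_eqF.
  apply: lerD.
    apply: (@le_trans _ _ (N (e + (e + (3 * e + (- 39 * e + e)))))); last by apply: Nle; lra.
    have dV0 : 0 <= d^-1 by rewrite invr_ge0 ltW.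
    have C2 : 0 <= 8 * C * C * (1 + r) by rewrite !mulr_ge0 ?addr_ge0 ?(ltW C0).
    have p3 : 0 <= k%:R `^ (2 - beta) * d^-1 by rewrite mulr_ge0 ?powR_ge0.
    have p2 : 0 <= K%:R `^ beta * (k%:R `^ (2 - beta) * d^-1).
      by rewrite mulr_ge0 ?powR_ge0.
    apply: (le_mul _ _ _ _ _ (mulr_ge0 C2 p2) Je) => //.
    apply: (le_mul _ _ _ _ _ p2 e8C) => //.
    apply: (le_mul _ _ _ _ _ p3 KB); first exact: powR_ge0.
    by apply: (le_mul _ _ _ _ _ dV0 kB); first exact: powR_ge0.
  have sV0 : 0 <= s^-1 by rewrite invr_ge0 ltW.
  apply: (@le_trans _ _ (N (e + (e + (e - 1 / 2))))); last by apply: Nle; lra.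
  have r8 : 0 <= 8 * r by rewrite mulr_ge0.
  apply: (le_mul _ _ _ _ _ (mulr_ge0 r8 sV0) Je) => //.
  exact: (le_mul _ _ _ _ r8 sV0 e8r).
have := query_prob_search_bounds A w0 wM n1 TS k0' s0 sW M0 ks Ds.
case/andP=> lo hi; apply/andP; split=> //; apply: le_trans lo.
(* The five copies of n^(-e): one for the endpoints, two for heavy queries, one each for large
   neighbourhoods and collisions. *)
rewrite lerD2l lerN2.
have b1 : 2 * (total_weight w / n%:R / k%:R) <= N (- e).
  apply: (@le_trans _ _ (N (e + (e + (e - 1 / 8))))); last by apply: Nle; lra.
  have dk0 : 0 <= d / k%:R by rewrite divr_ge0 ?(ltW d0).
  rewrite -[total_weight w / n%:R]/d; apply: (le_mul _ _ _ _ _ dk0) => //.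
  by apply: (le_mul _ _ _ _ (ltW d0)) => //; rewrite invr_ge0.
have b2' : T%:R * (4 * heavy_weight w k%:R / total_weight w) <= 2 * N (- e).
  apply: (@le_trans _ _ (N (10 * e) * (N (- 33 * e) + N (3 * e - 1 / 2)))).
    apply: ler_pM => //; rewrite divr_ge0 ?(ltW W0) // mulr_ge0 //.
    exact: sumr_ge0.
  rewrite mulrDr !NM (_ : 2 * N (- e) = N (- e) + N (- e)); last by ring.
  apply: lerD; apply: Nle; lra.
have b3' : T%:R * (k%:R / M%:R) <= N (- e).
  apply: (@le_trans _ _ (N (10 * e + (1 / 8 + (e - 1 / 4))))); last by apply: Nle; lra.
  have kM0 : 0 <= k%:R / M%:R :> R by rewrite divr_ge0.
  apply: (le_mul _ _ _ _ _ kM0 Thi) => //.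
  by apply: (le_mul _ _ _ _ _ _ khi) => //; rewrite invr_ge0.
have b4 : T%:R * ((2 + T * M)%:R * k%:R / s) <= N (- e).
  apply: (@le_trans _ _ (N (10 * e + (e + (10 * e + 1 / 4) + 1 / 8 + (e - 1 / 2))))); last first.
    by apply: Nle; lra.
  have Dk0 : 0 <= (2 + T * M)%:R * k%:R :> R by rewrite mulr_ge0.
  have Dks0 : 0 <= (2 + T * M)%:R * k%:R / s by rewrite divr_ge0 ?(ltW s0).
  apply: (le_mul _ _ _ _ _ Dks0 Thi) => //.
  apply: (le_mul _ _ _ _ Dk0 _ _ sV); first by rewrite invr_ge0 ltW.
  exact: le_mul.
by rewrite !mulrDr; move: b1 b2' b3' b4; lra.
Qed.

End Main.

Theorem mainTheorem4 (R : realType) (beta : R) (hbeta : 2 < beta < 3) :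
  exists2 delta : R, 0 < delta &
    forall (w : forall n : nat, 'I_n -> R) (d : nat -> R),
      (forall n : nat, expected_degrees (w n)) ->
      power_law beta w ->
      (forall n : nat, d n = avg_weight (w n)) ->
      subpolynomial d ->
      forall A : forall n : nat, algorithm R n,
        ((fun n : nat =>
           query_prob (w n) (A := A n) (fun E u v c =>
             forall q : nat, path_found E u v c q ->
               n%:R `^ delta <= q%:R :> R))
          @ \oo --> (1 : R))%classic.
Proof.
have b2 : 0 < beta - 2 by rewrite subr_gt0; case/andP: hbeta.
(* This is 10 e, so it depends on [beta] alone. *)
exists ((beta - 2) / 32); first by rewrite divr_gt0.
move=> w d wdeg [C [r [a [K [C0 r0 a0 Ksub pl]]]]] dE dsub A.
have e0 : 0 < (beta - 2) / 320 by rewrite divr_gt0.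
apply/cvgrPdist_le => eta eta0; near=> n.
have n1 : (1 < n)%N by near: n; exact: nbhs_infty_gt.
have n0 : 0 < n%:R :> R by rewrite ltr0n ltnW.
have dn : n%:R `^ (- ((beta - 2) / 320)) <= d n <= n%:R `^ ((beta - 2) / 320).
  by near: n; exact: subpolynomial_bounds.
have Kn : n%:R `^ (- ((beta - 2) / 320)) <= (K n)%:R <= n%:R `^ ((beta - 2) / 320).
  by near: n; exact: (subpolynomial_bounds Ksub).
have Jn : (trunc_log 2 n).+1%:R <= n%:R `^ ((beta - 2) / 320).
  by near: n; exact: trunc_log_le_powR.
have e3 : 3 <= n%:R `^ ((beta - 2) / 320) by near: n; exact: near_le_powR.
have e8C : 8 * C * C * (1 + r) <= n%:R `^ ((beta - 2) / 320).
  by near: n; exact: near_le_powR.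
have e8r : 8 * r <= n%:R `^ ((beta - 2) / 320) by near: n; exact: near_le_powR.
have e5 : 5 / eta <= n%:R `^ ((beta - 2) / 320) by near: n; exact: near_le_powR.
(* The lower half of subpolynomiality makes [K n] a positive natural number. *)
have K0 : (0 < K n)%N.
  case/andP: Kn => Kn _; rewrite -(ltr_nat R); apply: lt_le_trans Kn.
  by rewrite powR_gt0.
rewrite dE in dn; case/andP: Kn => _ Kn.
have pln : forall p q : nat, (K n <= p < q)%N ->
    let mass := a n * \sum_(p <= m < q) m%:R `^ (- beta) in
    window_fraction (w n) p q <= C * mass + r / n%:R /\
    ((exists i, q%:R <= w n i) -> C^-1 * mass - r / n%:R <= window_fraction (w n) p q).
  by near: n.
have /andP[lo hi] := query_prob_near_one hbeta (A n) n1 (wdeg n) dn C0 r0 (a0 n) K0 Kn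
  (ltnW (trunc_log_ltn n (isT : (1 < 2)%N))) Jn e3 e8C e8r pln.
rewrite ger0_norm ?subr_ge0 //.
apply: (@le_trans _ _ (5 * n%:R `^ (- ((beta - 2) / 320)))).
  by move: lo; lra.
by rewrite powRN ler_pdivrMr ?powR_gt0 // mulrC -ler_pdivrMr.
Unshelve. all: by end_near. Qed.
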